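(* Let $d\ge 2$. The skeleton of the Wythoffian $\beta_d(\{0,\ldots,d-2\})$ is isomorphic to the skeleton of $\mathsf{D}_d(\{0,\dots,d-1\})$, which is isometrically embeddable into the hypercube graph $H_{d(d-1)}$.
   Context: Complexes. A flag in a poset is a totally ordered subset. A connected poset $\mathcal{K}$ is an $n$-complex if every maximal flag has size $n+1$; each element (face) $x$ then has a dimension $\dim(x)\in\{0,\dots,n\}$, where minimal elements have dimension $0$ and $\dim(y)=\dim(x)+1$ whenever $y$ covers $x$. An $n$-complex is a polytope if every flag of size $n$ is contained in exactly two maximal flags; then each $1$-face (edge) lies above exactly two $0$-faces (vertices). The skeleton of a polytope is the graph formed by its vertices and edges. Wythoff construction. Let $\mathcal{K}$ be an $n$-complex and $\Delta=\{0,\dots,n\}$. The type of a flag $F$ is $t(F)=\{\dim(x): x\in F\}\subseteq\Delta$. Fix a nonempty $V\subseteq\Delta$. For nonempty $U,U'\subseteq\Delta$ write $U'\le U$ if for all $u\in U$, $v\in V$ there is $u'\in U'$ with $u\le u'\le v$ or $u\ge u'\ge v$. This is a preorder; write $U\sim U'$ if $U\le U'$ and $U'\le U$, and $U'<U$ if $U'\le U$ but $U\not\le U'$. Each $\sim$-class $[U]$ has a unique smallest (under inclusion) member $m([U])$ and a unique largest member $M([U])$; the sets $m([U])$ are called essential. The Wythoffian $\mathcal{K}(V)$ is the poset of all flags $F$ of $\mathcal{K}$ whose type is essential, with $F'<F$ iff $t(F')<t(F)$ and $F\cup F'$ is a flag. It is again an $n$-complex, with $\dim(F)=n+1-|M([t(F)])|$,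 and is a polytope if $\mathcal{K}$ is. The hyperoctahedron $\beta_d$ is the $(d-1)$-complex whose faces are the sets $X=\{\pm i_1,\ldots,\pm i_k\}$ with arbitrary signs and $\{i_1,\ldots,i_k\}$ a nonempty subset of $\{1,\dots,d\}$ (with $k$ elements), ordered by inclusion, with $\dim X=|X|-1$. Wythoff construction for finite Coxeter groups. Let $\mathsf{W}$ be a finite Coxeter group acting on $\mathbb{R}^d$ by isometries, with canonical generators $s_0,\dots,s_{d-1}$ acting as reflections in hyperplanes $H_0,\dots,H_{d-1}$ that bound a fundamental domain $\mathcal{S}$. For $T\subseteq\{0,\dots,d-1\}$ choose a point $v\in\mathcal{S}$ such that $v\in H_i$ if and only if $i\notin T$; then $\mathsf{W}(T)$ is the convex hull of the orbit $\mathsf{W}(v)$. Its combinatorial type depends only on $\mathsf{W}$ and $T$; its skeleton is the graph of its vertices and edges. Here $\mathsf{D}_d$ is the Coxeter group of isometries of $\mathbb{R}^d$ whose canonical generators are the orthogonal reflections in the hyperplanes $x_{i+1}-x_{i+2}=0$ ($0\le i\le d-2$) and $x_{d-1}+x_d=0$, with fundamental domain given by $x_{i+1}-x_{i+2}\ge 0$ ($0\le i\le d-2$) and $x_{d-1}+x_d\ge 0$. The hypercube graph $H_m$ has vertex set $\{0,1\}^m$, two vertices being adjacent when they differ in exactly one coordinate. A graph is isometrically embeddable in another if there is a map between vertex sets preserving path distances. *)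

(* Defs.v *)
From HB Require Import structures.
From mathcomp Require Import all_boot all_order all_algebra.
From mathcomp Require Import zify.

Set Implicit Arguments.
Unset Strict Implicit.
Unset Printing Implicit Defensive.

Import Order.TTheory GRing.Theory Num.Theory.

Record graph := Graph { vert : Type; adj : vert -> vert -> Prop }.

Definition graph_iso (G H : graph) : Prop :=
  exists2 f : vert G -> vert H,
    bijective f & forall x y, adj x y <-> adj (f x) (f y).

Fixpoint walk (G : graph) (n : nat) (x y : vert G) : Prop :=
  if n is m.+1 then exists2 z, adj x z & walk m z y else x = y.

(* The path distance as a relation, so that vertices in different components
   have no distance. *)
Definition is_dist (G : graph) (x y : vert G) (n : nat) : Prop :=
  walk n x y /\ forall m, walk m x y -> n <= m.

Definition isometrically_embeddable (G H : graph) : Prop :=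
  exists f : vert G -> vert H,
    forall x y n, is_dist x y n <-> is_dist (f x) (f y) n.

Definition hypercube (m : nat) : graph :=
  @Graph {ffun 'I_m -> bool} (fun x y => #|[set i | x i != y i]| = 1).

Section Poset.
Variables (disp : Order.disp_t) (K : finPOrderType disp).
Implicit Types (x y : K) (F : {set K}).

Definition flag F := [forall x in F, forall y in F, (x >=< y)%O].

(* [n] is fixed by [K]; the empty poset is excluded, its only maximal flag
   being empty. *)
Definition is_complex (n : nat) : Prop :=
  (forall x y, connect (fun a b : K => (a >=< b)%O) x y) /\
  (forall F, maxset flag F -> #|F| = n.+1).

(* Length of a longest flag with top element [x]. In an n-complex this is the
   function that vanishes on minimal elements and grows by one along covers:
   see [dim_minimal] and [dim_cover]. *)
Definition dim x : nat :=
  \max_(F : {set K} | flag F && [forall y in F, (y <= x)%O]) #|F|.-1.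

Lemma flagP F : reflect {in F &, forall x y, (x >=< y)%O} (flag F).
Proof.
apply: (iffP forall_inP) => [h x y xF yF|h x xF].
  by have /forall_inP := h x xF; apply.
by apply/forall_inP => y yF; apply: h.
Qed.

Lemma dim_ge x F : flag F -> {in F, forall y, (y <= x)%O} -> #|F|.-1 <= dim x.
Proof.
move=> fF Fx; rewrite /dim (bigD1 F) ?leq_maxl // fF /=.
by apply/forall_inP.
Qed.

Lemma flagU1 x F : flag F -> {in F, forall y, (x >=< y)%O} -> flag (x |: F).
Proof.
move=> /flagP fF xF; apply/flagP => a b.
rewrite !inE => /predU1P[->|aF] /predU1P[->|bF]; rewrite ?comparablexx ?xF //.
  by rewrite comparable_sym xF.
exact: fF.
Qed.

Lemma dim_witness x : exists F,
  [/\ flag F, {in F, forall y, (y <= x)%O}, x \in F & #|F| = (dim x).+1].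
Proof.
have s1 : flag [set x] && [forall y in [set x], (y <= x)%O].
  apply/andP; split; last by apply/forall_inP => y /set1P->.
  by apply/flagP => a b /set1P-> /set1P->; apply: comparablexx.
have ne : 0 < #|[pred F | flag F && [forall y in F, (y <= x)%O]]|.
  by rewrite (cardD1 [set x]) inE s1.
have [F] := eq_bigmax_cond (fun F : {set K} => #|F|.-1) ne.
rewrite inE => /andP[fF /forall_inP Fx].
rewrite (_ : \max_(_ in _) _ = dim x); last by apply: eq_bigl.
move=> dF; exists (x |: F).
have fxF : flag (x |: F).
  by apply: flagU1 => // y /Fx yx; rewrite comparable_sym le_comparable.
have xFx : {in x |: F, forall y, (y <= x)%O}.
  by move=> y /setU1P[->|/Fx].
split=> //; first exact: setU11.
have xF0 : 0 < #|x |: F| by apply/card_gt0P; exists x; apply: setU11.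
move: (dim_ge fxF xFx) xF0 dF; rewrite cardsU1.
by case: (x \in F) => /=; lia.
Qed.

Lemma dim_lt x y : (x < y)%O -> dim x < dim y.
Proof.
move=> xy; have [F [fF Fx xF cF]] := dim_witness x.
have yNF : y \notin F by apply/negP => /Fx; rewrite lt_geF.
have h : {in F, forall z, (z <= y)%O} by move=> z /Fx zx; rewrite (le_trans zx) ?ltW.
have := @dim_ge y (y |: F); rewrite cardsU1 yNF cF /=.
apply; first by apply: flagU1 => // z /h zy; rewrite comparable_sym le_comparable.
by move=> z /setU1P[->|/h].
Qed.

Lemma dim_minimal x : (forall y, ~~ (y < x)%O) -> dim x = 0.
Proof.
move=> mx; have [F [_ Fx xF cF]] := dim_witness x.
apply/eqP; rewrite -eqSS -cF; apply/cards1P; exists x; apply/setP => y.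
rewrite inE; apply/idP/eqP => [/Fx|-> //].
by rewrite le_eqVlt (negPf (mx y)) orbF => /eqP.
Qed.

Lemma flag_le_card n F : is_complex n -> flag F -> #|F| <= n.+1.
Proof.
move=> [_ cK] fF; have [G mG FG] := maxset_exists fF.
by rewrite -(cK G mG) subset_leq_card.
Qed.

Lemma dim_leq n x : is_complex n -> dim x <= n.
Proof.
move=> cK; have [F [fF _ _ cF]] := dim_witness x.
by have := flag_le_card cK fF; rewrite cF ltnS.
Qed.

Lemma dim_cover n x y : is_complex n ->
  (x < y)%O -> (forall z, ~~ ((x < z)%O && (z < y)%O)) -> dim y = (dim x).+1.
Proof.
move=> cK xy cov; apply/eqP; rewrite eqn_leq dim_lt // andbT.
have [A [fA Ax xA cA]] := dim_witness x.
have [C [fC Cy yC cC]] := dim_witness y.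
have Ay : {in A, forall z, (z < y)%O} by move=> z /Ax zx; apply: le_lt_trans xy.
have fyA : flag (y |: A).
  by apply: flagU1 => // z /Ay zy; rewrite comparable_sym lt_comparable.
have [F mF sF] := maxset_exists fyA.
have fF : flag F by case/maxsetP: mF.
have yF : y \in F by rewrite (subsetP sF) ?setU11.
have AF : A \subset F by apply: subset_trans sF; apply: subsetUr.
have xF := subsetP AF _ xA.
pose B := [set z in F | (y < z)%O].
have splitF : F \subset A :|: (y |: B).
  apply/subsetP => z zF; rewrite !inE zF /=.
  have /flagP cF := fF.
  have [|yz|->] := comparable_ltgtP (cF _ _ zF yF); rewrite ?orbT //.
  move=> zy; apply/orP; left.
  have zx : (z <= x)%O.
    have /orP[//|xz] := cF _ _ zF xF.
    move: xz; rewrite le_eqVlt => /predU1P[->//|xz].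
    by have := cov z; rewrite xz zy.
  have {}zA : flag (z |: A).
    apply: flagU1 => // w wA; apply: cF => //; exact: (subsetP AF).
  have zAx : {in z |: A, forall w, (w <= x)%O} by move=> w /setU1P[->|/Ax].
  have := dim_ge zA zAx; rewrite cardsU1 cA.
  by case: (z \in A) => //=; rewrite ltnn.
have cF : #|F| = n.+1 by case: cK => _; apply.
have := subset_leq_card splitF; rewrite cF.
have fCB : flag (C :|: B).
  have /flagP cF' := fF; have /flagP cC' := fC.
  have CB a b : a \in C -> b \in B -> (a <= b)%O.
    by move=> /Cy ay; rewrite inE => /andP[_ yb]; rewrite (le_trans ay) ?ltW.
  apply/flagP => a b /setUP[aC|aB] /setUP[bC|bB].
  - exact: cC'.
  - by rewrite le_comparable ?CB.
  - by rewrite comparable_sym le_comparable ?CB.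
  - by move: aB bB; rewrite !inE => /andP[aF _] /andP[bF _]; apply: cF'.
have := flag_le_card cK fCB.
have -> : #|C :|: B| = #|C| + #|B|.
  apply/eqP; rewrite (leq_card_setU C B).2 -setI_eq0; apply/eqP/setP => z.
  rewrite !inE; apply/negP => /and3P[/Cy zy _ yz].
  by have := le_lt_trans zy yz; rewrite ltxx.
have := leq_trans (leq_card_setU A (y |: B)) (leqnn _); rewrite cardsU1 cA cC.
move: #|B| (y \in B) #|_ :|: _| (dim x) (dim y) => b yB t p q.
by clear; case: yB => /=; lia.
Qed.

Definition skeleton : graph :=
  @Graph {x : K | dim x == 0}
    (fun x y : {x : K | dim x == 0} =>
       x <> y /\ exists2 e : K, dim e = 1 & (val x < e)%O && (val y < e)%O).

End Poset.

Section Wythoff.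
Variables (n : nat) (V : {set 'I_n.+1}).
Implicit Types U : {set 'I_n.+1}.

(* [wle U' U] is U' <= U, relative to [V]; it is only meant for nonempty sets,
   hence the nonemptiness conditions in [essential]. *)
Definition wle U' U :=
  [forall u in U, forall v in V, exists u' in U',
     (u <= u' <= v) || (v <= u' <= u)].

Definition wlt U' U := wle U' U && ~~ wle U U'.

Definition wsim U' U := wle U' U && wle U U'.

(* [U] is the smallest member of its class. *)
Definition essential U :=
  (U != set0) &&
  [forall U' : {set 'I_n.+1}, (U' != set0) && wsim U' U ==> (U \subset U')].

Lemma wleP U' U :
  reflect (forall u v, u \in U -> v \in V ->
             exists2 u', u' \in U' & (u <= u' <= v) || (v <= u' <= u))
          (wle U' U).
Proof.
apply: (iffP forall_inP) => [h u v uU vV|h u uU].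
  by have /forall_inP/(_ v vV)/exists_inP := h u uU.
by apply/forall_inP => v vV; apply/exists_inP; apply: h.
Qed.

Lemma wle_trans U1 U2 U3 : wle U1 U2 -> wle U2 U3 -> wle U1 U3.
Proof.
move=> /wleP h12 /wleP h23; apply/wleP => u v uU vV.
have [b bU ub] := h23 u v uU vV; have [a aU ab] := h12 b v bU vV.
by exists a => //; lia.
Qed.

Lemma wlt_irr U : wlt U U = false.
Proof. by rewrite /wlt andbN. Qed.

Lemma wlt_trans U1 U2 U3 : wlt U1 U2 -> wlt U2 U3 -> wlt U1 U3.
Proof.
move=> /andP[h12 n21] /andP[h23 _]; rewrite /wlt (wle_trans h12) //=.
by apply: contra n21; apply: wle_trans.
Qed.

Lemma essential_isolated U (a : 'I_n.+1) : V != set0 -> essential U -> a \in U ->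
  exists2 v, v \in V &
    forall u, u \in U -> (a <= u <= v) || (v <= u <= a) -> u = a.
Proof.
move=> /set0Pn[v0 v0V] /andP[_ /forallP ess] aU.
have aNU : ~~ (U \subset U :\ a).
  by apply/negP => /subsetP/(_ a aU); rewrite !inE eqxx.
have := ess (U :\ a); rewrite (negPf aNU) implybF => /nandP[].
  rewrite negbK => /eqP U0; exists v0 => // u uU _; apply/eqP.
  have : u \notin U :\ a by rewrite U0 inE.
  by rewrite !inE uU andbT negbK.
have sub : wle U (U :\ a).
  by apply/wleP => u v /setD1P[_ uU] _; exists u => //; lia.
rewrite /wsim sub andbT => /forall_inPn[u uU /forall_inPn[v vV /exists_inPn h]].
have ua : u = a.
  apply/eqP; apply: contraT => una.
  have := h u; rewrite !inE una uU => /(_ isT); lia.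
subst u; exists v => // w wU wav; apply/eqP; apply: contraT => wna.
by have := h w; rewrite !inE wna wU wav => /(_ isT).
Qed.

End Wythoff.

Section FlagType.
Variables (disp : Order.disp_t) (K : finPOrderType disp) (n : nat).

Definition flag_type (F : {set K}) : {set 'I_n.+1} :=
  [set i : 'I_n.+1 | [exists x in F, dim x == i]].

Hypothesis cK : is_complex K n.

Lemma flag_typeP (F : {set K}) (i : 'I_n.+1) :
  reflect (exists2 x, x \in F & dim x = i) (i \in flag_type F).
Proof.
by rewrite inE; apply: (iffP exists_inP) => -[x xF /eqP]; exists x => //; apply/eqP.
Qed.

Lemma flag_dim_le (F : {set K}) x y :
  flag F -> x \in F -> y \in F -> dim x <= dim y -> (x <= y)%O.
Proof.
move=> /flagP fF xF yF xy; have /orP[//|yx] := fF x y xF yF.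
move: yx; rewrite le_eqVlt => /predU1P[->//|/dim_lt]; lia.
Qed.

Lemma wythoff_flag_trans V (F1 F2 F3 : {set K}) :
  flag F1 -> flag F3 -> essential V (flag_type F1) ->
  wlt V (flag_type F1) (flag_type F2) -> wlt V (flag_type F2) (flag_type F3) ->
  flag (F1 :|: F2) -> flag (F2 :|: F3) -> flag (F1 :|: F3).
Proof.
move=> f1 f3 ess /andP[/wleP h12 n21] /andP[/wleP h23 _] f12 f23.
have V0 : V != set0.
  apply: contra n21 => /eqP ->; apply/wleP => u v _; by rewrite inE.
suff key x z : x \in F1 -> z \in F3 -> (x >=< z)%O.
  have /flagP g1 := f1; have /flagP g3 := f3.
  apply/flagP => a b /setUP[aF|aF] /setUP[bF|bF].
  - exact: g1.
  - exact: key.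
  - by rewrite comparable_sym key.
  - exact: g3.
move=> xF zF.
have lt_d (w : K) : dim w < n.+1 by rewrite ltnS; apply: dim_leq cK.
have xT : Ordinal (lt_d x) \in flag_type F1 by apply/flag_typeP; exists x.
have zT : Ordinal (lt_d z) \in flag_type F3 by apply/flag_typeP; exists z.
have [v vV iso] := essential_isolated V0 ess xT.
have [b /flag_typeP[y yF yb] bz] := h23 _ _ zT vV.
have [a aT ab] := h12 b v (introT (flag_typeP _ _) (ex_intro2 _ _ y yF yb)) vV.
have {iso} iso : (dim x <= a <= v) || (v <= a <= dim x) -> a = dim x :> nat.
  by move=> h; rewrite (iso a aT h).
have {iso ab bz yb} : (dim x <= dim y <= dim z) \/ (dim z <= dim y <= dim x).
  move: iso ab bz; rewrite -yb /=.
  move: (dim x) (dim y) (dim z) (nat_of_ord a) (nat_of_ord v).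
  by clear => x y z a v; have [le_xy|lt_yx] := leqP x y => iso ab bz; lia.
have y12 : y \in F1 :|: F2 by rewrite inE yF orbT.
have y23 : y \in F2 :|: F3 by rewrite inE yF.
have x12 : x \in F1 :|: F2 by rewrite inE xF.
have z23 : z \in F2 :|: F3 by rewrite inE zF orbT.
case=> /andP[h1 h2].
  apply: le_comparable.
  exact: le_trans (flag_dim_le f12 x12 y12 h1) (flag_dim_le f23 y23 z23 h2).
rewrite comparable_sym; apply: le_comparable.
exact: le_trans (flag_dim_le f23 z23 y23 h1) (flag_dim_le f12 y12 x12 h2).
Qed.

End FlagType.

(* The Wythoffian K(V) of an n-complex K. *)
Record wythoffian (disp : Order.disp_t) (K : finPOrderType disp) (n : nat)
    (cK : is_complex K n) (V : {set 'I_n.+1}) := Wythoffian {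
  wflag :> {set K};
  wflagP : flag wflag && essential V (flag_type n wflag)
}.

HB.instance Definition _ disp K n cK V :=
  [isSub for @wflag disp K n cK V].
HB.instance Definition _ disp K n cK V :=
  [Finite of @wythoffian disp K n cK V by <:].

Section WythoffOrder.
Variables (disp : Order.disp_t) (K : finPOrderType disp) (n : nat).
Variables (cK : is_complex K n) (V : {set 'I_n.+1}).
Local Notation W := (wythoffian cK V).

Definition wythoff_lt (F' F : W) : bool :=
  wlt V (flag_type n F') (flag_type n F) && flag (F :|: F').

Lemma wythoff_lt_irr : irreflexive wythoff_lt.
Proof. by move=> F; rewrite /wythoff_lt wlt_irr. Qed.

Lemma wythoff_lt_trans : transitive wythoff_lt.
Proof.
move=> F2 F1 F3 /andP[t12 f12] /andP[t23 f23].
have /andP[f1 e1] := wflagP F1; have /andP[f3 _] := wflagP F3.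
rewrite /wythoff_lt (wlt_trans t12 t23) setUC.
by rewrite (wythoff_flag_trans cK f1 f3 e1 t12 t23) // setUC.
Qed.

HB.instance Definition _ :=
  Order.Lt_isPOrder.Build disp W wythoff_lt_irr wythoff_lt_trans.

End WythoffOrder.

Section Hyperoctahedron.
Variable d : nat.

(* [(i, true)] and [(i, false)] stand for +(i+1) and -(i+1). *)
Definition signed (X : {set 'I_d * bool}) :=
  [forall i, ~~ (((i, true) \in X) && ((i, false) \in X))].

Record hyperoctahedron := Hyperoctahedron {
  hset :> {set 'I_d * bool};
  hsetP : (hset != set0) && signed hset
}.

HB.instance Definition _ := [isSub for hset].
HB.instance Definition _ := [Finite of hyperoctahedron by <:].

Definition hle (X Y : hyperoctahedron) := hset X \subset hset Y.

Lemma hle_refl : reflexive hle. Proof. by move=> X; apply: subxx. Qed.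

Lemma hle_anti : antisymmetric hle.
Proof. by move=> X Y XY; apply/val_inj/eqP; rewrite eqEsubset. Qed.

Lemma hle_trans : transitive hle.
Proof. by move=> Y X Z; apply: subset_trans. Qed.

Fact hyperoctahedron_display : Order.disp_t.
Proof. exact: (Order.Disp tt tt). Qed.

HB.instance Definition _ := Order.Le_isPOrder.Build
  hyperoctahedron_display hyperoctahedron hle_refl hle_anti hle_trans.

Lemma signedP (X : {set 'I_d * bool}) :
  reflect {in X &, injective fst} (signed X).
Proof.
apply: (iffP forallP) => [h [i []] [j []] /= iX jX ij|h i].
- by rewrite ij.
- by move: iX; rewrite ij => iX; have := h j; rewrite iX jX.
- by move: iX; rewrite ij => iX; have := h j; rewrite iX jX.
- by rewrite ij.
by apply/negP => /andP[tX fX]; have := h _ _ tX fX erefl.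
Qed.

Lemma signed_sub (X Y : {set 'I_d * bool}) :
  X \subset Y -> signed Y -> signed X.
Proof.
by move=> /subsetP XY /signedP h; apply/signedP => p q /XY pY /XY; apply: h.
Qed.

Lemma signed_card (X : {set 'I_d * bool}) : signed X -> #|X| <= d.
Proof.
by move=> /signedP h; rewrite -(card_in_imset h) -[leqRHS]card_ord max_card.
Qed.

Lemma signed_extend (X : {set 'I_d * bool}) : signed X ->
  exists Y : {set 'I_d * bool}, [/\ X \subset Y, signed Y & #|Y| = d].
Proof.
move=> /signedP h.
pose Y := [set p | (p \in X) || (((p.1, false) \notin X) && p.2)].
exists Y; have sY : signed Y.
  apply/forallP => i; rewrite !inE /= andbF orbF andbT; apply/negP.
  move=> /andP[/orP[tX fX|/negP //]].
  by have := h _ _ tX fX erefl.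
split=> //; first by apply/subsetP => p pX; rewrite inE pX.
move/signedP: sY => /card_in_imset <-; rewrite -[RHS]card_ord -cardsT.
congr #|pred_of_set _|; apply/setP => i; rewrite inE; apply/imsetP.
have [fX|fX] := boolP ((i, false) \in X).
  by exists (i, false) => //; rewrite inE fX.
by exists (i, true) => //; rewrite inE fX orbT.
Qed.

Lemma subset_between (T : finType) (A B : {set T}) (k : nat) :
  A \subset B -> #|A| <= k <= #|B| ->
  exists C : {set T}, [/\ A \subset C, C \subset B & #|C| = k].
Proof.
move=> AB; elim: k => [|k IH] /andP[Ak kB].
  by exists A; split=> //; lia.
have [Ak'|] := leqP #|A| k; last by exists A; split=> //; lia.
have [|C [AC CB cC]] := IH; first by lia.
have /properP[_ [x xB xC]] : C \proper B by rewrite properEcard CB cC.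
exists (x |: C); split; last by rewrite cardsU1 xC cC.
  exact: subset_trans AC (subsetUr _ _).
by rewrite subUset sub1set xB.
Qed.

Lemma hleE (X Y : hyperoctahedron) : (X <= Y)%O = (hset X \subset hset Y).
Proof. by []. Qed.

Lemma hset_card (X : hyperoctahedron) : 0 < #|X| <= d.
Proof.
by have /andP[X0 sX] := hsetP X; rewrite card_gt0 X0 signed_card.
Qed.

Lemma hflag_sub (F : {set hyperoctahedron}) (X Y : hyperoctahedron) :
  flag F -> X \in F -> Y \in F -> #|X| <= #|Y| -> hset X \subset hset Y.
Proof.
move=> /flagP fF XF YF cXY; have /orP[//|] := fF X Y XF YF.
by rewrite hleE => YX; have /eqP -> : hset Y == hset X by rewrite eqEcard YX.
Qed.

Lemma hflag_complete (F : {set hyperoctahedron}) (k : nat) :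
  maxset (@flag _ hyperoctahedron) F -> 0 < k <= d ->
  exists2 X : hyperoctahedron, X \in F & #|X| = k.
Proof.
move=> /maxsetP[fF mF] /andP[k0 kd].
have [/exists_inP[X XF /eqP cX]|/exists_inPn nF] :=
  boolP [exists X : hyperoctahedron in F, #|X| == k]; first by exists X.
have [A [sA kA loA hiA]] : exists A : {set 'I_d * bool}, [/\ signed A, #|A| < k,
    forall X : hyperoctahedron, X \in F -> #|X| < k -> hset X \subset A
  & forall X : hyperoctahedron, X \in F -> k < #|X| -> A \subset hset X].
  have [/exists_inP[X0 X0F X0k]|/exists_inPn no] :=
    boolP [exists X : hyperoctahedron in F, #|X| < k].
    pose P (X : hyperoctahedron) := (X \in F) && (#|X| < k).
    have PX0 : P X0 by rewrite /P X0F.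
    case: (arg_maxnP (fun X : hyperoctahedron => #|X|) PX0) => X /andP[XF Xk] mX.
    exists (hset X); split=> //; first by case/andP: (hsetP X).
      by move=> Y YF Yk; apply: (hflag_sub fF YF XF); apply: mX; rewrite /P YF.
    by move=> Y YF Yk; apply: (hflag_sub fF XF YF); apply: ltnW (ltn_trans Xk Yk).
  exists set0; split; rewrite ?cards0 //; first by apply/signedP => p; rewrite inE.
    by move=> X XF; rewrite (negPf (no X XF)).
  by move=> X _ _; apply: sub0set.
have [B [sB kB AB hiB]] : exists B : {set 'I_d * bool}, [/\ signed B, k <= #|B|,
    A \subset B
  & forall X : hyperoctahedron, X \in F -> k < #|X| -> B \subset hset X].
  have [/exists_inP[X0 X0F X0k]|/exists_inPn no] :=
    boolP [exists X : hyperoctahedron in F, k < #|X|].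
    pose P (X : hyperoctahedron) := (X \in F) && (k < #|X|).
    have PX0 : P X0 by rewrite /P X0F.
    case: (arg_minnP (fun X : hyperoctahedron => #|X|) PX0) => X /andP[XF Xk] mX.
    exists (hset X); split=> //; first by case/andP: (hsetP X).
    - exact: ltnW.
    - exact: hiA.
    - by move=> Y YF Yk; apply: (hflag_sub fF XF YF); apply: mX; rewrite /P YF.
  have [B [AB sB cB]] := signed_extend sA.
  by exists B; rewrite cB; split=> // X XF; rewrite (negPf (no X XF)).
have [|C [AC CB cC]] := subset_between (k := k) AB.
  by rewrite kB ltnW.
have C0 : (C != set0) && signed C.
  by rewrite -card_gt0 cC k0 (signed_sub CB sB).
exists (Hyperoctahedron C0) => //.
rewrite -(mF (Hyperoctahedron C0 |: F)) ?setU11 ?subsetUr //.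
apply: flagU1 => // X XF; have [Xk|Xk|Xk] := ltngtP #|X| k.
- by rewrite comparable_sym le_comparable // hleE (subset_trans _ AC) ?loA.
- by rewrite le_comparable // hleE (subset_trans CB) ?hiB.
- by have := nF X XF; rewrite Xk eqxx.
Qed.

Lemma hyperoctahedron_complex : 2 <= d -> is_complex hyperoctahedron d.-1.
Proof.
move=> d2; split; last first.
  move=> F mF; have fF : flag F by case/maxsetP: mF.
  have lt_c (X : hyperoctahedron) : #|X|.-1 < d by have := hset_card X; lia.
  pose f X := Ordinal (lt_c X).
  have f_inj : {in F &, injective f}.
    move=> X Y XF YF [] eXY; apply: val_inj; apply/eqP.
    have cXY : #|X| = #|Y|.
      have /andP[X0 _] := hset_card X; have /andP[Y0 _] := hset_card Y.
      by rewrite -(prednK X0) -(prednK Y0) eXY.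
    by rewrite eqEsubset !(hflag_sub fF) ?cXY.
  rewrite -(card_in_imset f_inj) prednK ?(ltnW d2) // -[RHS]card_ord -cardsT.
  congr #|pred_of_set _|; apply/setP => i; rewrite inE; apply/imsetP.
  have [|X XF cX] := @hflag_complete F i.+1 mF; first by rewrite /= ltn_ord.
  by exists X => //; apply: val_inj; rewrite /= cX.
set e := fun a b : hyperoctahedron => (a >=< b)%O.
have eC : connect_sym e.
  by apply: (@sym_connect_sym _ e) => a b; apply: comparable_sym.
have face (p q : 'I_d * bool) : p.1 != q.1 ->
    exists X : hyperoctahedron, hset X = [set p; q].
  move=> pq; have h : ([set p; q] != set0) && signed [set p; q].
    apply/andP; split; first by apply/set0Pn; exists p; rewrite set21.
    apply/signedP => a b /set2P[]-> /set2P[]-> //= eq; by rewrite eq eqxx in pq.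
  by exists (Hyperoctahedron h).
have single (p : 'I_d * bool) : exists X : hyperoctahedron, hset X = [set p].
  have h : ([set p] != set0) && signed [set p].
    apply/andP; split; first by apply/set0Pn; exists p; rewrite set11.
    by apply/signedP => a b /set1P-> /set1P->.
  by exists (Hyperoctahedron h).
have up (X Y : hyperoctahedron) : hset X \subset hset Y -> connect e X Y.
  by move=> XY; apply: connect1; apply: le_comparable.
have edge (p q : 'I_d * bool) (P Q : hyperoctahedron) :
    hset P = [set p] -> hset Q = [set q] -> p.1 != q.1 -> connect e P Q.
  move=> hP hQ /face[X hX]; apply: (@connect_trans _ e X).
    by apply: up; rewrite hP hX sub1set set21.
  by rewrite eC; apply: up; rewrite hQ hX sub1set set22.
have vertices (p q : 'I_d * bool) (P Q : hyperoctahedron) :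
    hset P = [set p] -> hset Q = [set q] -> connect e P Q.
  move=> hP hQ; have [pq|] := eqVneq p.1 q.1; last exact: edge hP hQ.
  have [r rp] : exists r : 'I_d, r != p.1.
    have lt0 : 0 < d by exact: ltnW.
    have [->|] := eqVneq p.1 (Ordinal lt0); first by exists (Ordinal d2).
    by rewrite eq_sym; exists (Ordinal lt0).
  have [Z hZ] := single (r, true); apply: (@connect_trans _ e Z).
    by apply: edge hP hZ _; rewrite eq_sym.
  by apply: edge hZ hQ _; rewrite -pq.
move=> X Y; have /andP[/set0Pn[p pX] _] := hsetP X.
have /andP[/set0Pn[q qY] _] := hsetP Y.
have [P hP] := single p; have [Q hQ] := single q.
apply: (@connect_trans _ e P); first by rewrite eC; apply: up; rewrite hP sub1set.
apply: (@connect_trans _ e Q); first exact: vertices hP hQ.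
by apply: up; rewrite hQ sub1set.
Qed.

Lemma dim_hyperoctahedron (X : hyperoctahedron) : dim X = #|X|.-1.
Proof.
apply/eqP; rewrite eqn_leq; apply/andP; split.
  have [F [fF FX _ cF]] := dim_witness X.
  pose f (Y : hyperoctahedron) : 'I_#|X|.-1.+1 := inord #|Y|.-1.
  have bnd (Y : hyperoctahedron) : Y \in F -> #|Y|.-1 < #|X|.-1.+1.
    by move=> /FX YX; rewrite ltnS -!subn1 leq_sub2r // subset_leq_card.
  have f_inj : {in F &, injective f}.
    move=> Y Z YF ZF /(congr1 val); rewrite /= !inordK ?bnd //.
    have /andP[Y0 _] := hset_card Y; have /andP[Z0 _] := hset_card Z.
    move=> eYZ; have cYZ : #|Y| = #|Z| by rewrite -(prednK Y0) -(prednK Z0) eYZ.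
    by apply: val_inj; apply/eqP; rewrite eqEsubset !(hflag_sub fF) ?cYZ.
  by rewrite -ltnS -cF -(card_in_imset f_inj) -[leqRHS]card_ord max_card.
have: #|X| = #|X|.-1.+1 by have /andP[X0 _] := hset_card X; rewrite prednK.
move: #|X|.-1 => k; elim: k X => // k IH X cX.
have [|C [_ CX cC]] := subset_between (k := k.+1) (sub0set (hset X)).
  by rewrite cards0 cX /=.
have hC : (C != set0) && signed C.
  by have /andP[_ sX] := hsetP X; rewrite -card_gt0 cC (signed_sub CX sX).
apply: leq_ltn_trans (IH (Hyperoctahedron hC) cC) _; apply: dim_lt.
rewrite lt_neqAle hleE CX andbT; apply/eqP => eC.
by have := cC; rewrite -[C]/(hset (Hyperoctahedron hC)) eC cX; lia.
Qed.

End Hyperoctahedron.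

From mathcomp Require Import boolp classical_sets reals convex.

Section Geometry.
Local Open Scope classical_set_scope.
Local Open Scope ring_scope.
Variables (R : realType) (d : nat).
Implicit Types (u v x : 'rV[R]_d) (P F : set 'rV[R]_d).

Definition dot u v : R := \sum_i u 0 i * v 0 i.

Definition convex_hull (A : set 'rV[R]_d) : set 'rV[R]_d :=
  smallest (@convex_set R 'rV[R]_d) A.

Definition is_face P F : Prop :=
  exists c b, (forall x, P x -> dot c x <= b) /\
              F = [set x | P x /\ dot c x = b].

Definition has_affine_dim (k : nat) F : Prop :=
  exists p (A : 'M[R]_(k, d)),
    [/\ row_free A, F p, forall i, F (p + row i A)
      & forall x, F x -> (x - p <= A)%MS].

Definition vertices P : set 'rV[R]_d := [set x | is_face P [set x]].

Definition polytope_skeleton P : graph :=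
  @Graph (vertices P)
    (fun x y : vertices P => x <> y /\
       exists2 e, is_face P e /\ has_affine_dim 1 e & e (val x) /\ e (val y)).

Definition reflection u x : 'rV[R]_d := x - (2 * dot u x / dot u u) *: u.

(* The hyperplanes [H_i] are given by normals [a i] pointing into the
   fundamental domain. *)
Variable a : 'I_d -> 'rV[R]_d.

Definition reflection_group : set ('rV[R]_d -> 'rV[R]_d) :=
  [set g | exists s : seq 'I_d,
     g = foldr (fun i h => reflection (a i) \o h) idfun s].

Definition fundamental_domain : set 'rV[R]_d :=
  [set x | forall i, 0 <= dot (a i) x].

Definition wythoff_point (T : {set 'I_d}) v : Prop :=
  fundamental_domain v /\ forall i, dot (a i) v = 0 <-> i \notin T.

(* The polytope W(T) obtained from the choice of [v]. *)
Definition wythoff_polytope v : set 'rV[R]_d :=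
  convex_hull [set g v | g in reflection_group].

End Geometry.

(* Normals of the canonical generators of D_d, with coordinates numbered from 0:
   e_i - e_(i+1) for i < d - 1, and e_(d-2) + e_(d-1) for i = d - 1. *)
Definition D_normal (R : realType) (d : nat) (i : 'I_d) : 'rV[R]_d :=
  (\row_j if (i.+1 < d)%N then (j == i :> nat)%:R - (j == i.+1 :> nat)%:R
          else (j.+2 == d)%:R + (j.+1 == d)%:R)%R.

Lemma dot_D_normal (R : realType) (d : nat) (i : 'I_d) (f : nat -> R) : 1 < d ->
  (dot (D_normal R i) (\row_j f j) =
  if (i.+1 < d)%N then f i - f i.+1 else f (d - 2)%N + f (d - 1)%N)%R.
Proof.
move=> d1.
have sumd k : k < d -> (\sum_(j < d) ((j : nat) == k)%:R * f j = f k)%R.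
  move=> kd; rewrite (bigD1 (Ordinal kd)) //= eqxx mul1r big1 ?addr0 // => j.
  by rewrite -val_eqE /= => /negPf->; rewrite mul0r.
rewrite /dot; under eq_bigr do rewrite !mxE.
case: ifP => id.
  by under eq_bigr do rewrite mulrBl; rewrite sumrB !sumd.
under eq_bigr do rewrite mulrDl.
rewrite big_split -[in RHS]sumd; last by lia.
rewrite -[X in (_ = _ + X)%R]sumd; last by lia.
congr (_ + _)%R; apply: eq_bigr => j _; congr ((nat_of_bool _)%:R * _)%R; lia.
Qed.

Lemma wythoff_point_D (R : realType) (d : nat) : 1 < d ->
  wythoff_point (@D_normal R d) [set: 'I_d]%SET (\row_j (d - 1 - j)%N%:R)%R.
Proof.
move=> d1.
have pos i : (0 < dot (@D_normal R d i) (\row_j (d - 1 - j)%N%:R))%R.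
  rewrite (@dot_D_normal R d i (fun j => (d - 1 - j)%N%:R)%R) //; case: ifP => id.
    by rewrite -natrB ?ltr0n; lia.
  by rewrite -natrD ltr0n; lia.
split=> i; first exact/ltW.
rewrite finset.in_setT; split=> // /eqP; by rewrite gt_eqF.
Qed.

(* Main.v *)
From Pilot Require Import Defs.
From mathcomp Require Import all_boot all_order all_algebra.
From mathcomp Require Import reals.
From mathcomp Require Import fingroup perm alt zify ring lra.
From mathcomp Require boolp classical_sets convex interval_inference.
Import Pilot.Defs.

Set Implicit Arguments.
Unset Strict Implicit.
Unset Printing Implicit Defensive.
Import Order.TTheory GRing.Theory Num.Theory.

(** Both skeletons are the Cayley graph of the Coxeter group D_d with respect
    to its simple reflections, and the Cayley graph of a finite reflection
    group embeds isometrically in a cube whose coordinates are the reflections.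

    The group is realised as [Dgroup]: the even permutations of the 2d signed
    points (+-i) that commute with negation. A change of one sign is a single
    transposition and an exchange of two coordinates is a product of two, so
    evenness as a permutation says exactly that the number of sign changes is
    even. An element [w] moves positions to levels: the associated point of the
    orbit of [v] has value [v (w p)] at the signed position [p], and the
    associated flag has as its face of size k the set of positions whose level
    is among the first k. Only the order of the values matters, and since [v] is
    dominant this order is given by the integer [rk]. The group theory needed
    is one fact, [dominant_eq1]: an element of [Dgroup] preserving the order
    along every simple root is the identity.

    Isometry ([D_graph_isometric]). Send [w] to the vector recording, for each
    of the d(d-1) reflections, on which side of its hyperplane the chamber of
    [w] lies. A simple reflection preserves the sign of every positive root but
    one ([srefl_lt]), so an edge changes one coordinate; and if [w] differs from
    [w'], then [dominant_eq1] gives a wall of the chamber of [w] separating it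
    from that of [w'], and crossing it brings the two vectors closer.

    Wythoffian ([wythoffian_D_graph]). The types of the vertices and of the
    edges come out of a description of the essential sets: those not containing
    both d-2 and d-1. A vertex is a flag with faces of sizes 1, ..., d-1, and two
    vertices are joined when they differ in a single face, with the extra
    condition, when that face is the largest, that the two largest faces lie in
    a common facet ([differ_at_of_edge], [edge_of_differ_at]). That condition
    excludes a change of sign of one coordinate and leaves the two simple
    reflections that act at the end of the Coxeter diagram
    ([srefl_of_differ_at]).

    Polytope ([polytope_D_graph]). The key is [dominance]: the difference of [v]
    and any other point of its orbit is a nonnegative combination of simple
    roots. A linear form maximal at [v] is nonnegative on simple roots, so a face
    containing [v] and another point of the orbit contains the image of [v]
    under some simple reflection. All points of the orbit lie on a sphere, which
    a line meets twice, so if the face is a segment that image is its other end.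
    Conversely the form given by [v] plus its image vanishes on one simple root
    only, and its face is the segment joining the two. *)

(** * Path distances and isometric embeddings *)

Section Distances.
Variable G : graph.
Implicit Types x y : vert G.

(** A function [delta] that decreases by at most one along every edge is a
    lower bound for the distance; as some edge always decreases it, greedy
    descent produces a walk of that length. *)
Lemma is_distE (delta : vert G -> vert G -> nat) :
  (forall x, delta x x = 0) ->
  (forall x y z, adj x z -> delta x y <= (delta z y).+1) ->
  (forall x y, x = y \/ exists2 z, adj x z & delta x y = (delta z y).+1) ->
  forall x y n, is_dist x y n <-> n = delta x y.
Proof.
move=> dxx lip step.
have lb n x y : walk n x y -> delta x y <= n.
  elim: n x => [|n IH] x /=; first by move=> ->; rewrite dxx.
  by case=> z xz /IH zy; apply: leq_trans (lip _ _ _ xz) _; rewrite ltnS.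
have geodesic x y : walk (delta x y) x y.
  have [k dk] := ubnP (delta x y); elim: k x dk => // k IH x.
  have [->|[z xz ->]] := step x y; first by rewrite dxx.
  by move=> dz; exists z => //; apply: IH.
move=> x y n; split=> [[xy min]|->].
  by apply/eqP; rewrite eqn_leq lb // min.
by split=> [|k /lb].
Qed.

End Distances.

Lemma hypercube_step (n : nat) (x y z : {ffun 'I_n -> bool}) (c : 'I_n) :
  [set i | x i != z i] = [set c] -> x c != y c ->
  #|[set i | x i != y i]| = #|[set i | z i != y i]|.+1.
Proof.
move=> /setP xz xy; have zy : (z c == y c).
  by have := xz c; rewrite !inE eqxx; move: xy; do 3![case: (_ c)].
rewrite (cardsD1 c) inE xy; congr _.+1; apply: eq_card => i.
rewrite !inE; have [->|ic] := eqVneq i c; first by rewrite zy.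
by have := xz i; rewrite !inE (negPf ic) => /negbFE/eqP->.
Qed.

Lemma hypercube_dist (n : nat) (x y : vert (hypercube n)) (k : nat) :
  is_dist x y k <-> k = #|[set i | x i != y i]|.
Proof.
move: x y k; apply: is_distE => [x|x y z|x y].
- by apply/eqP; rewrite cards_eq0 -subset0; apply/subsetP => i; rewrite !inE eqxx.
- move=> /eqP/cards1P[c /setP xz].
  rewrite -[X in _ <= X]add1n -(cards1 c).
  apply: leq_trans (leq_card_setU _ _); apply/subset_leq_card/subsetP => i.
  by have := xz i; rewrite !inE; case: (i == c) => //= /negbFE/eqP->.
- have [->|] := eqVneq x y; [by left | move=> xy; right].
  have /existsP[c xyc] : [exists c, x c != y c].
    rewrite -negb_forall; apply: contra xy => /forallP h.
    by apply/eqP/ffunP => i; apply/eqP.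
  pose z := [ffun i => if i == c then ~~ x i else x i].
  have xz : [set i | x i != z i] = [set c].
    apply/setP => i; rewrite !inE ffunE; case: (i == c); last by rewrite eqxx.
    by case: (x i).
  by exists z; [rewrite /= xz cards1|apply: hypercube_step xz xyc].
Qed.

(** It is enough to find, for two distinct vertices, one step along which a
    coordinate that distinguishes them is corrected: the Hamming distance of the
    images is then a function to which [is_distE] applies. *)
Lemma isometric_of_steps (G : graph) (n : nat) (f : vert G -> vert (hypercube n)) :
  (forall x z, adj x z -> adj (f x) (f z)) ->
  (forall x y, x = y \/
     exists z c, [/\ adj x z, f x c != f z c & f x c != f y c]) ->
  isometrically_embeddable G (hypercube n).
Proof.
move=> fadj step; exists f => x y k.
rewrite hypercube_dist; move: x y k; apply: is_distE => [x|x y z xz|x y].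
- by apply/eqP; rewrite cards_eq0 -subset0; apply/subsetP => i; rewrite !inE eqxx.
- have /eqP/cards1P[c /setP fxz] := fadj _ _ xz.
  rewrite -[X in _ <= X]add1n -(cards1 c).
  apply: leq_trans (leq_card_setU _ _); apply/subset_leq_card/subsetP => i.
  by have := fxz i; rewrite !inE; case: (i == c) => //= /negbFE/eqP->.
- have [->|[z [c [xz xzc xyc]]]] := step x y; [by left | right; exists z => //].
  have /eqP/cards1P[c' fxz] := fadj _ _ xz.
  have cc' : c = c' by apply/set1P; rewrite -fxz inE.
  by apply: hypercube_step xyc; rewrite fxz cc'.
Qed.

Lemma graph_iso_of_common (G H1 H2 : graph) (f1 : vert G -> vert H1)
    (f2 : vert G -> vert H2) :
  bijective f1 -> (forall x y, adj x y <-> adj (f1 x) (f1 y)) ->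
  bijective f2 -> (forall x y, adj x y <-> adj (f2 x) (f2 y)) ->
  graph_iso H1 H2.
Proof.
move=> [g1 f1K g1K] a1 [g2 f2K g2K] a2; exists (f2 \o g1).
  by exists (f1 \o g2) => x; rewrite /= ?f2K ?f1K ?g1K ?g2K.
by move=> x y; rewrite -{1}[x]g1K -{1}[y]g1K -a1 a2.
Qed.

Lemma isometric_iso (G G' H : graph) (f : vert G -> vert G') :
  bijective f -> (forall x y, adj x y <-> adj (f x) (f y)) ->
  isometrically_embeddable G H -> isometrically_embeddable G' H.
Proof.
move=> [g fK gK] fadj [e eP]; exists (e \o g).
have wf n x y : walk n x y <-> walk n (f x) (f y).
  elim: n x => [|n IH] x /=; first by split=> [->//|/(can_inj fK)].
  split=> [[z /fadj xz /IH zy]|[z xz zy]]; first by exists (f z).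
  by exists (g z); [apply/fadj|apply/IH]; rewrite gK.
move=> x y n; rewrite -eP -{1}[x]gK -{1}[y]gK; split=> -[w min]; split.
- exact/wf.
- by move=> k /wf; apply: min.
- exact/wf.
- by move=> k /wf; apply: min.
Qed.

Lemma bijective_of_surj (A B : Type) (f : A -> B) :
  injective f -> (forall b, exists a, f a = b) -> bijective f.
Proof.
move=> f_inj f_surj; pose g b := projT1 (boolp.cid (f_surj b)).
have gK b : f (g b) = b by rewrite /g; case: boolp.cid.
by exists g => // a; apply: f_inj.
Qed.

(** * Signed permutations and the Cayley graph of D_d *)

Section SignedPermutations.
Variable m : nat.
Local Notation d := m.+2.
Local Notation spt := ('I_d * bool)%type.
Implicit Types (p q s : spt) (w u : {perm spt}).

Definition negp p : spt := (p.1, ~~ p.2).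

Lemma negpK : involutive negp.
Proof. by case=> i b; rewrite /negp negbK. Qed.

Definition negp_perm : {perm spt} := perm (can_inj negpK).

Definition Dgroup : {set {perm spt}} := ('C[negp_perm] :&: 'Alt_spt)%g.
Canonical Dgroup_group := Eval hnf in [group of Dgroup].

Lemma DgroupP w :
  reflect ((forall p, w (negp p) = negp (w p)) /\ ~~ odd_perm w) (w \in Dgroup).
Proof.
rewrite inE Alt_even; apply: (iffP andP) => -[h ->]; split=> //.
  move=> p; have /cent1P/permP/(_ p) := h.
  by rewrite !permM !permE.
by apply/cent1P/permP => p; rewrite !permM !permE h.
Qed.

Lemma Dgroup_negp w p : w \in Dgroup -> w (negp p) = negp (w p).
Proof. by case/DgroupP. Qed.

Lemma negp_neq p : negp p != p.
Proof. by rewrite -pair_eqE /= eqxx; case: p.2. Qed.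

Lemma eq_fst_negp p q : p.1 = q.1 -> q = p \/ q = negp p.
Proof.
by case: p q => i [] [j []] /= ->; [left|right|right|left].
Qed.

Lemma Dgroup_fst w p q : w \in Dgroup -> ((w p).1 == (w q).1) = (p.1 == q.1).
Proof.
move=> wD; apply/eqP/eqP => /eq_fst_negp[] => [/perm_inj->//||->//|->].
  by rewrite -Dgroup_negp // => /perm_inj->.
by rewrite Dgroup_negp.
Qed.

(** The orthogonal reflection exchanging the signed basis vectors [p] and [q],
    and hence their opposites. *)
Definition sswap p q : {perm spt} := (tperm p q * tperm (negp p) (negp q))%g.

Lemma sswapE p q s : p.1 != q.1 ->
  sswap p q s = if s == p then q else if s == q then p else
             if s == negp p then negp q else if s == negp q then negp p else s.
Proof.
case: p q s => i b [j c] [k e] /= ij; rewrite permM.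
rewrite !permE /= /negp /= -!pair_eqE /=.
have [->|ki] := eqVneq k i.
  by rewrite !(negPf ij); case: b c e => -[] [] /=; rewrite ?eqxx ?(eq_sym j) ?(negPf ij) ?andbF.
have [->|kj] := eqVneq k j.
  by case: b c e => -[] [] /=; rewrite ?eqxx ?(eq_sym j) ?(negPf ij) ?andbF ?andbT //=.
by rewrite /= (negPf ki) (negPf kj).
Qed.

Lemma sswapL p q : p.1 != q.1 -> sswap p q p = q.
Proof. by move=> pq; rewrite sswapE // eqxx. Qed.

Lemma sswapR p q : p.1 != q.1 -> sswap p q q = p.
Proof. by move=> pq; rewrite sswapE // eqxx; case: (eqVneq q p) pq => // ->; rewrite eqxx. Qed.

Lemma sswap_id p q s : p.1 != q.1 -> s.1 != p.1 -> s.1 != q.1 -> sswap p q s = s.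
Proof.
move=> pq sp sq; rewrite sswapE // -!pair_eqE /= /negp /=.
by rewrite (negPf sp) (negPf sq).
Qed.

Lemma sswap_Dgroup p q : p.1 != q.1 -> sswap p q \in Dgroup.
Proof.
move=> pq; apply/DgroupP; split=> [s|]; last first.
  rewrite odd_mul_tperm odd_tperm (inj_eq (can_inj negpK)) addbb //.
rewrite !sswapE //; have op x y : (negp x == y) = (x == negp y).
  by rewrite -[in LHS](negpK y) (inj_eq (can_inj negpK)).
rewrite !op !negpK.
have ne : [/\ q == p = false, p == negp q = false & q == negp p = false].
  split; apply/negP => /eqP e; move: pq; rewrite e /= ?eqxx //.
case: ne => qp pq' qp'.
have [->|sp] := eqVneq s p; rewrite ?negpK.
  by rewrite eq_sym (negPf (negp_neq _)) pq'.
have [->|sq] := eqVneq s q; rewrite ?negpK.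
  by rewrite [q == negp q]eq_sym (negPf (negp_neq _)) qp'.
by case: ifP => _; [|case: ifP => _]; rewrite ?negpK.
Qed.

Lemma sswapK p q : p.1 != q.1 -> (sswap p q * sswap p q = 1)%g.
Proof.
move=> pq; apply/permP => s; rewrite permM perm1.
have swo r : sswap p q (negp r) = negp (sswap p q r) by apply/Dgroup_negp/sswap_Dgroup.
rewrite [sswap p q s]sswapE //.
have [->|sp] := eqVneq s p; first by rewrite sswapR.
have [->|sq] := eqVneq s q; first by rewrite sswapL.
have [->|sp'] := eqVneq s (negp p); first by rewrite swo sswapR.
have [->|sq'] := eqVneq s (negp q); first by rewrite swo sswapL.
by rewrite sswapE // (negPf sp) (negPf sq) (negPf sp') (negPf sq').
Qed.

(** Position of a signed point in the chain of values of a dominant vector,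
    largest value first. The two signs of the last coordinate are not ordered by
    dominance; they share the middle rank d-1. *)
Definition rk p : nat := if p.2 then p.1 : nat else m.+1.*2 - p.1.

Lemma rk_negp p : rk (negp p) + rk p = m.+1.*2.
Proof. by rewrite /rk /=; case: p => i b /=; have := ltn_ord i; case: b => /=; lia. Qed.

Lemma rk_fst p : (rk p <= m.+1 /\ p.1 = rk p :> nat) \/
  (m.+1 <= rk p /\ (p.1 + rk p)%N = m.+1.*2 :> nat).
Proof. by rewrite /rk; case: p => i b /=; have := ltn_ord i; case: b => /=; lia. Qed.

Lemma rk_inj p q : rk p = rk q -> q = p \/ q = negp p.
Proof.
move=> h; apply/eq_fst_negp/val_inj => /=.
by have := rk_fst p; have := rk_fst q; lia.
Qed.

Lemma rk_neq p q : p.1 != q.1 -> rk p != rk q.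
Proof. by move=> pq; apply: contra pq => /eqP/rk_inj[]->. Qed.

Lemma rk_small p : rk p < m.+1 -> p.2.
Proof. by rewrite /rk; case: p.2 => //; have := ltn_ord p.1; lia. Qed.

(** The simple root number [i] is [e_p - e_q] for [(p, q) = wall i]. Since
    [e_p] stands for minus a basis vector when the sign of [p] is [false], the
    last simple root, a sum of two basis vectors, has this form too. The ranks
    of [p] and [q] are always consecutive. *)
Definition wall (i : 'I_d) : spt * spt :=
  if i.+1 < d then ((i, true), (inord i.+1, true))
  else ((inord m, true), (ord_max, false)).
Local Notation P i := (wall i).1.
Local Notation Q i := (wall i).2.

Lemma rk_wall i : rk (P i) = minn i m /\ rk (Q i) = (rk (P i)).+1.
Proof.
rewrite /wall; have := ltn_ord i; case: (boolP (i.+1 < d)) => h; rewrite /rk /= inordK; lia.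
Qed.

Lemma wall_fst i : (P i).1 != (Q i).1.
Proof.
rewrite -val_eqE /wall; have := ltn_ord i.
by case: (boolP (i.+1 < d)) => h; rewrite /= inordK; lia.
Qed.

Definition srefl i : {perm spt} := sswap (P i) (Q i).

Lemma srefl_Dgroup i : srefl i \in Dgroup.
Proof. exact/sswap_Dgroup/wall_fst. Qed.

Lemma sreflK i : (srefl i * srefl i = 1)%g.
Proof. exact/sswapK/wall_fst. Qed.

Lemma sreflL i : srefl i (P i) = Q i.
Proof. exact/sswapL/wall_fst. Qed.

Lemma sreflR i : srefl i (Q i) = P i.
Proof. exact/sswapR/wall_fst. Qed.

Lemma sreflV i : ((srefl i)^-1 = srefl i)%g.
Proof. by apply/(mulgI (srefl i)); rewrite sreflK mulgV. Qed.

Lemma wall_lt i : rk (P i) < rk (Q i).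
Proof. by have [_ ->] := rk_wall i. Qed.

Definition pos k : spt := (inord k, true).

Lemma rk_pos k : k <= m.+1 -> rk (pos k) = k.
Proof. by move=> km; rewrite /rk /= inordK. Qed.

Lemma pos_ord (i : 'I_d) : (i, true) = pos i.
Proof. by rewrite /pos inord_val. Qed.

Lemma wall_inord k : k <= m -> wall (inord k) = (pos k, pos k.+1).
Proof.
move=> km; have kd : k < d by lia.
by rewrite /wall /pos inordK //; case: ifP => //; lia.
Qed.

Lemma wall_max : wall ord_max = (pos m, negp (pos m.+1)).
Proof.
rewrite /wall /= ltnn; congr (_, (_, _)); apply: val_inj.
by rewrite /= inordK.
Qed.

(** The group acts simply transitively on chambers. The conditions for the
    simple roots bound the rank of [w (pos k)] below by [k], up to the middle
    rank; as ranks of opposite points add up to 2(d-1), the two branches at the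
    end of the diagram force equality at the top, and then all the way down.
    What is left is a possible change of sign of the last coordinate, an odd
    permutation. *)
Lemma dominant_eq1 w : w \in Dgroup ->
  (forall i, rk (w (P i)) < rk (w (Q i))) -> w = 1%g.
Proof.
move=> wD dom.
have wo p : rk (w (negp p)) + rk (w p) = m.+1.*2 by rewrite Dgroup_negp // rk_negp.
have up k : k <= m -> rk (w (pos k)) < rk (w (pos k.+1)).
  by move=> km; have := dom (inord k); rewrite wall_inord.
have last : rk (w (pos m)) < rk (w (negp (pos m.+1))).
  by have := dom ord_max; rewrite wall_max.
have ge k : k <= m.+1 -> k <= rk (w (pos k)).
  elim: k => // k IH km; apply: leq_ltn_trans (IH (ltnW km)) _; exact: up.
have top : rk (w (pos m.+1)) = m.+1 /\ rk (w (pos m)) <= m.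
  have := wo (pos m.+1); have := ge m.+1 (leqnn _); have := ge m (leqnSn _).
  have := up m (leqnn _); lia.
have le k : k <= m -> rk (w (pos (m - k))) <= m - k.
  elim: k => [|k IH] km; first by rewrite subn0; case: top.
  have := up (m - k.+1) (leq_subr _ _); have -> : (m - k.+1).+1 = m - k by lia.
  by have := IH (ltnW km); lia.
have fixc k : k <= m.+1 -> rk (w (pos k)) = k.
  move=> km; have := ge k km; have [km'|km'] := leqP k m.
    by have := le (m - k) (leq_subr _ _); rewrite subKn //; lia.
  by have -> : k = m.+1; [lia | case: top].
have wc k : k <= m -> w (pos k) = pos k.
  move=> km; have km1 : k <= m.+1 by lia.
  have /rk_inj[//|eq] : rk (pos k) = rk (w (pos k)) by rewrite rk_pos // fixc.
  by have := fixc k km1; rewrite eq; have := rk_negp (pos k); rewrite rk_pos //; lia.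
have [wtop|wtop] : w (pos m.+1) = pos m.+1 \/ w (pos m.+1) = negp (pos m.+1).
  by apply: rk_inj; rewrite rk_pos // fixc.
  apply/permP => -[i b]; rewrite perm1.
  have wi : w (i, true) = (i, true).
    rewrite pos_ord; have := ltn_ord i; rewrite ltnS leq_eqVlt => /predU1P[->//|im].
    by rewrite wc.
  by case: b => //; rewrite -[(i, false)]/(negp (i, true)) Dgroup_negp ?wi.
have : w = tperm (pos m.+1) (negp (pos m.+1)).
  apply/permP => p.
  have [->|p1] := eqVneq p (pos m.+1); first by rewrite tpermL.
  have [->|p2] := eqVneq p (negp (pos m.+1)).
    by rewrite tpermR Dgroup_negp // wtop negpK.
  rewrite tpermD ?(eq_sym _ p) //.
  have pm : p.1 < m.+1.
    have := ltn_ord p.1; rewrite ltnS leq_eqVlt => /predU1P[eq|//].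
    have /eq_fst_negp[] : (pos m.+1).1 = p.1 by apply: val_inj; rewrite /= inordK.
      by move=> e; rewrite e eqxx in p1.
    by move=> e; rewrite e eqxx in p2.
  have /eq_fst_negp[] : (pos p.1).1 = p.1 by rewrite /pos inord_val.
    by move=> ->; rewrite wc //= inord_val -ltnS.
  by move=> ->; rewrite Dgroup_negp // wc //= inord_val -ltnS.
move=> wt; have /DgroupP[_] := wD.
by rewrite wt odd_tperm eq_sym negp_neq.
Qed.

Lemma descent w : w \in Dgroup -> w != 1%g ->
  exists i, rk (w (Q i)) < rk (w (P i)).
Proof.
move=> wD w1; apply/existsP; apply: contraNT w1; rewrite negb_exists.
move=> /forallP h; apply/eqP/dominant_eq1 => // i.
have := h i; rewrite -leqNgt leq_eqVlt => /predU1P[e|//].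
by have := wall_fst i; rewrite -(Dgroup_fst _ _ wD) => /rk_neq; rewrite e eqxx.
Qed.

(** Whether [(p, q)] and [(p', q')] define the same hyperplane: the root
    [e_p - e_q] is also [e_(-q) - e_(-p)], and its opposite defines the same
    reflection. *)
Definition same_root p q p' q' :=
  ((p', q') == (p, q)) || ((p', q') == (q, p)) ||
  (((p', q') == (negp p, negp q)) || ((p', q') == (negp q, negp p))).

Lemma srefl_cases i s :
  [\/ s = P i, s = Q i, s = negp (P i) | s = negp (Q i)] \/
  [/\ srefl i s = s, rk s != rk (P i), rk s != rk (Q i),
       rk s != rk (negp (P i)) & rk s != rk (negp (Q i))].
Proof.
have [->|sP] := eqVneq s (P i); first by left; constructor 1.
have [->|sQ] := eqVneq s (Q i); first by left; constructor 2.
have [->|sP'] := eqVneq s (negp (P i)); first by left; constructor 3.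
have [->|sQ'] := eqVneq s (negp (Q i)); first by left; constructor 4.
have ne p : s != p -> s != negp p -> rk s != rk p.
  move=> sp sp'; apply/eqP => /rk_inj[] e; first by rewrite e eqxx in sp.
  by rewrite e negpK eqxx in sp'.
right; split; [|exact: ne|exact: ne|by apply: ne; rewrite ?negpK..].
by rewrite /srefl sswapE ?wall_fst // (negPf sP) (negPf sQ) (negPf sP') (negPf sQ').
Qed.

(** A simple reflection preserves the sign of every root except that of the
    simple root itself, because the two points it exchanges have consecutive
    ranks: no third coordinate has its value between theirs. *)
Lemma srefl_lt i p q : p.1 != q.1 ->
  (rk (srefl i p) < rk (srefl i q)) =
  (rk p < rk q) (+) same_root (P i) (Q i) p q.
Proof.
move=> pq; have [mP mQ] := rk_wall i.
have oP := rk_negp (P i); have oQ := rk_negp (Q i).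
have ro s : srefl i (negp s) = negp (srefl i s) by apply/Dgroup_negp/srefl_Dgroup.
have cl a b : reflect (p = a /\ q = b) ((p, q) == (a, b)).
  by apply: (iffP eqP) => [[]|[->->]].
have [pc|[pr p1 p2 p3 p4]] := srefl_cases i p;
have [qc|[qr q1 q2 q3 q4]] := srefl_cases i q.
- have ne (a b : spt) : a.1 != b.1 -> (a == b = false) * (b == a = false).
    by move=> ab; rewrite [b == a]eq_sym; case: (eqVneq a b) ab => // ->; rewrite eqxx.
  have nPQ := wall_fst i.
  have oo a : (negp a == a = false) * (a == negp a = false).
    by rewrite [a == _]eq_sym (negPf (negp_neq a)).
  rewrite /same_root; move: pq.
  case: pc => ->; case: qc => -> /=; rewrite ?eqxx // => _;
  rewrite ?xpair_eqE ?eqxx ?oo ?(ne (P i) (Q i)) ?(ne (P i) (negp (Q i)))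
    ?(ne (negp (P i)) (negp (Q i))) ?(ne (negp (P i)) (Q i)) //=;
  rewrite ?ro ?sreflL ?sreflR; lia.
- have -> : same_root (P i) (Q i) p q = false.
    apply/negP => /orP[/orP[]|/orP[]] /cl[_ e]; move: q1 q2 q3 q4; rewrite e ?eqxx //.
  rewrite qr addbF.
  by case: pc => ->; rewrite ?ro ?sreflL ?sreflR; lia.
- have -> : same_root (P i) (Q i) p q = false.
    apply/negP => /orP[/orP[]|/orP[]] /cl[e _]; move: p1 p2 p3 p4; rewrite e ?eqxx //.
  rewrite pr addbF.
  by case: qc => ->; rewrite ?ro ?sreflL ?sreflR; lia.
- have -> : same_root (P i) (Q i) p q = false.
    apply/negP => /orP[/orP[]|/orP[]] /cl[e _]; move: p1 p2 p3 p4; rewrite e ?eqxx //.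
  by rewrite pr qr addbF.
Qed.

Lemma last_ord (i : 'I_d) : ~~ (i <= m) -> i = ord_max.
Proof. by move=> im; apply: val_inj => /=; have := ltn_ord i; lia. Qed.

Lemma rk_lt_pos (p : spt) k : k < d -> rk p < k -> p = pos (rk p).
Proof.
move=> kd pk; have p2 : p.2 by apply: rk_small; lia.
by case: p p2 pk => i [] // _ _; apply: pos_ord.
Qed.

Lemma rk_srefl_le i (s : spt) : rk (srefl i s) <= (rk s).+1.
Proof.
have [mP mQ] := rk_wall i; have oP := rk_negp (P i); have oQ := rk_negp (Q i).
have ro t : srefl i (negp t) = negp (srefl i t) by apply/Dgroup_negp/srefl_Dgroup.
by have [[]|[]] := srefl_cases i s => ->; rewrite ?ro ?sreflL ?sreflR; lia.
Qed.

Lemma rk_srefl_lt i (s : spt) (j : nat) : j < d -> j != (rk (P i)).+1 ->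
  (rk (srefl i s) < j) = (rk s < j).
Proof.
have [mP mQ] := rk_wall i; have oP := rk_negp (P i); have oQ := rk_negp (Q i).
have ro t : srefl i (negp t) = negp (srefl i t) by apply/Dgroup_negp/srefl_Dgroup.
by have [[]|[]] := srefl_cases i s => ->; rewrite ?ro ?sreflL ?sreflR; lia.
Qed.

(** Ranks determine the wall except for the two branches at the end of the
    diagram, which meet in the same first point and have opposite second
    points. *)
Lemma wall_same i i' : rk (P i) = rk (P i') ->
  i = i' \/ (P i' = P i /\ Q i' = negp (Q i)).
Proof.
have wi (j : 'I_d) : (j <= m /\ wall j = (pos j, pos j.+1)) \/
            (j = ord_max /\ wall j = (pos m, negp (pos m.+1))).
  have [jm|jm] := boolP (j <= m); last by right; rewrite (last_ord jm) wall_max.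
  by left; split=> //; rewrite -{1}[j]inord_val wall_inord.
have [-> _] := rk_wall i; have [-> _] := rk_wall i'.
have [[im wiE]|[iM wiE]] := wi i; have [[im' wiE']|[iM' wiE']] := wi i'.
- by rewrite !(minn_idPl _) // => /val_inj; left.
- rewrite wiE wiE' (minn_idPl im) iM' (minn_idPr _) // => ->.
  by right.
- rewrite wiE wiE' (minn_idPl im') iM (minn_idPr _) // => <-.
  by right; rewrite negpK.
- by left; rewrite iM iM'.
Qed.

Lemma srefl_neq1 i : srefl i != 1%g.
Proof.
apply/eqP => r1; have := wall_fst i.
by rewrite -(sreflL i) r1 perm1 eqxx.
Qed.

Lemma rk_lt_fst p k : k < d -> rk p < k -> p.1 < k.
Proof. by have := rk_fst p; lia. Qed.

Lemma le_rk_fst p k : k <= rk p -> k <= rk (negp p) -> k <= p.1.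
Proof. by have := rk_negp p; have := rk_fst p; lia. Qed.

(** The Cayley graph. Multiplication by a generator on the right acts on
    levels, hence crosses a wall of the chamber; on the left it would act on
    positions. *)
Definition D_graph : graph :=
  @Graph {w : {perm spt} | w \in Dgroup}
    (fun w w' : {w : {perm spt} | w \in Dgroup} => exists i, val w' = (val w * srefl i)%g).

Definition D_vert w (wD : w \in Dgroup) : vert D_graph := exist _ w wD.

Definition root_pairs : {set 'I_d * 'I_d} := [set ij | ij.1 != ij.2].

Lemma card_root_pairs : #|root_pairs| = d * (d - 1).
Proof.
rewrite (_ : root_pairs = ~: [set (i, i) | i in 'I_d]); last first.
  apply/setP => -[i j]; rewrite !inE /=; congr (~~ _).
  by apply/eqP/imsetP => [->|[k _ [-> ->]]] //; exists j.
rewrite cardsCs setCK card_prod card_imset ?card_ord => [|i j []//].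
by rewrite mulnBr muln1.
Qed.

(** The d(d-1) reflections are indexed by ordered pairs of distinct indices:
    [(i, j)] stands for the root [e_i - e_j] when [i < j] and for [e_i + e_j]
    when [j < i]. *)
Definition root_pair (k : 'I_(d * (d - 1))) : spt * spt :=
  let ij := enum_val (cast_ord (esym card_root_pairs) k) in
  ((ij.1, true), (ij.2, ij.1 < ij.2)).

Lemma root_pair_fst k : (root_pair k).1.1 != (root_pair k).2.1.
Proof.
by have := enum_valP (cast_ord (esym card_root_pairs) k); rewrite inE.
Qed.

(** Of the four pairs of signed points giving the same reflection, two have a
    positive first point, and the second sign required by [root_pair] selects
    one of them by the order of the indices. *)
Lemma root_pair_repr p q : p.1 != q.1 ->
  exists k, forall k', same_root p q (root_pair k').1 (root_pair k').2 = (k' == k).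
Proof.
move=> pq.
pose ij := if (p.2 == q.2) == (p.1 < q.1) then (p.1, q.1) else (q.1, p.1).
have ijP : ij \in root_pairs by rewrite inE /ij; case: ifP => _ //=; rewrite eq_sym.
exists (cast_ord card_root_pairs (enum_rank_in ijP ij)) => k'.
rewrite -(inj_eq (@cast_ord_inj _ _ (esym card_root_pairs))) cast_ordK.
rewrite /root_pair; set e := cast_ord _ k'.
rewrite -(inj_eq enum_val_inj) enum_rankK_in //.
have := enum_valP e; rewrite inE; move: (enum_val e) => -[a b] /= ab.
rewrite /ij {ij ijP e k'}; case: p q pq => [i x] [j y] /= ij.
rewrite /same_root /negp /= (fun_if (eq_op (a, b))) !xpair_eqE.
move: ij ab; rewrite -!val_eqE /=.
move: (nat_of_ord a) (nat_of_ord b) (nat_of_ord i) (nat_of_ord j) => {}a {}b {}i {}j.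
by case: x; case: y => /=; case: (ltngtP i j) => //= ?; case: (ltngtP a b) => //=; lia.
Qed.

Definition inversions (w : vert D_graph) : vert (hypercube (d * (d - 1))) :=
  [ffun k => rk (val w (root_pair k).1) < rk (val w (root_pair k).2)].

(** Crossing the wall [i] of the chamber of [w] changes only the coordinate
    of that wall, which is the image of the simple root under the inverse of
    [w]. *)
Lemma inversions_srefl (w w' : vert D_graph) i : val w' = (val w * srefl i)%g ->
  exists2 c, [set k | inversions w k != inversions w' k] = [set c] &
    same_root ((val w)^-1%g (P i)) ((val w)^-1%g (Q i)) (root_pair c).1 (root_pair c).2.
Proof.
case: w w' => [w wD] [w' w'D] /= w'E.
have /root_pair_repr[c cP] : (w^-1%g (P i)).1 != (w^-1%g (Q i)).1.
  by rewrite Dgroup_fst ?groupV // wall_fst.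
exists c; last by rewrite cP.
apply/setP => k; rewrite !inE !ffunE /= w'E !(permM w) srefl_lt; last first.
  by rewrite Dgroup_fst // root_pair_fst.
rewrite -cP; have -> : forall b c, (b != b (+) c) = c by case=> -[].
have eqV p q : (w p == q) = (p == w^-1%g q).
  by rewrite -(inj_eq (@perm_inj _ w^-1%g)) permK.
rewrite /same_root -!pair_eqE /= !eqV !(Dgroup_negp _ (groupVr wD)) //.
Qed.

Lemma same_root_lt p q p' q' : same_root p q p' q' ->
  (forall w, w \in Dgroup -> (rk (w p) < rk (w q)) = (rk (w p') < rk (w q'))) \/
  (forall w, w \in Dgroup -> (rk (w p) < rk (w q)) = (rk (w q') < rk (w p'))).
Proof.
have h w : w \in Dgroup -> (rk (w (negp q)) < rk (w (negp p))) = (rk (w p) < rk (w q)).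
  by move=> wD; have := rk_negp (w p); have := rk_negp (w q); rewrite !Dgroup_negp //; lia.
case/orP => [/orP[]|/orP[]] /eqP[-> ->];
  by [left => w /h //|right => w /h //].
Qed.

(** If no wall of the chamber of [w] separated it from the chamber of [w'],
    then [w^-1 * w'] would be dominant, hence trivial. *)
Lemma D_graph_isometric : isometrically_embeddable D_graph (hypercube (d * (d - 1))).
Proof.
apply: (@isometric_of_steps _ _ inversions) => [w w' [i wE]|[w wD] [w' w'D]].
  by have [c ic _] := inversions_srefl wE; rewrite /= ic cards1.
have [ww'|ww'] := eqVneq (w^-1 * w')%g 1%g.
  left; apply: val_inj => /=.
  by rewrite -[RHS](mulKVg w) ww' mulg1.
right; have uD : (w^-1 * w')%g \in Dgroup by rewrite groupM ?groupV.
have [i] := descent uD ww'; rewrite !(permM w^-1) => lt_i.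
have zD : (w * srefl i)%g \in Dgroup by rewrite groupM ?srefl_Dgroup.
have [c cE cr] := @inversions_srefl (D_vert wD) (D_vert zD) i erefl.
exists (D_vert zD), c; split; first by exists i.
  by have /setP/(_ c) := cE; rewrite !inE eqxx.
rewrite !ffunE; move: cr (root_pair_fst c) (wall_lt i).
move: (root_pair c) => -[p q] /= /same_root_lt h pq lt_i'.
have nw := @rk_neq (w p) (w q); have nw' := @rk_neq (w' p) (w' q).
move: nw nw'; rewrite !Dgroup_fst // => /(_ pq) + /(_ pq).
have [] := h => {}h; have := h _ wD; have := h _ w'D; rewrite !permKV; lia.
Qed.
End SignedPermutations.

(** * Vertices and edges of the Wythoffian *)

Lemma dim_le1 (disp : Order.disp_t) (K : finPOrderType disp) (x : K) :
  (forall y, (y < x)%O -> dim y = 0) -> dim x <= 1.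
Proof.
move=> low; have [F [/flagP fF Fx xF cF]] := dim_witness x.
have : #|F :\ x| = dim x by move: cF; rewrite (cardsD1 x) xF; lia.
move=> <-; apply/card_le1_eqP => y z /setD1P[yx yF] /setD1P[zx zF].
have ylt : (y < x)%O by rewrite lt_neqAle yx Fx.
have zlt : (z < x)%O by rewrite lt_neqAle zx Fx.
have [/dim_lt|/dim_lt|//] := comparable_ltgtP (fF y z yF zF).
  by rewrite (low z zlt).
by rewrite (low y ylt).
Qed.

Section WythoffianSkeleton.
Variables (m : nat) (hd : 2 <= m.+2).
Local Notation d := m.+2.
Local Notation K := (hyperoctahedron d).
Local Notation V := [set i : 'I_d.-1.+1 | i <= d - 2].
Local Notation W := (wythoffian (hyperoctahedron_complex hd) V).
Local Notation typ F := (flag_type d.-1 (F : {set K})).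
Implicit Types (X Y : K) (F G e : W) (U : {set 'I_d}) (i j : 'I_d) (H : {set K}).

Lemma hypercard_inj H X Y : flag H -> X \in H -> Y \in H -> #|X| = #|Y| -> X = Y.
Proof.
move=> fH XH YH cXY; apply/val_inj/eqP.
by rewrite /= eqEsubset !(hflag_sub fH) ?cXY.
Qed.

Lemma hflagS (H H' : {set K}) : H \subset H' -> flag H' -> flag H.
Proof. by move=> /subsetP HH' /flagP fH; apply/flagP => x y /HH' + /HH'; apply: fH. Qed.

Lemma in_typ H (i : 'I_d) : reflect (exists2 X, X \in H & #|X| = i.+1) (i \in typ H).
Proof.
have dimE X : (dim X == i :> nat) = (#|X| == i.+1).
  by rewrite dim_hyperoctahedron; have := hset_card X; lia.
rewrite inE; apply: (iffP exists_inP) => -[X XH cX]; exists X => //.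
  by apply/eqP; rewrite -dimE.
by rewrite dimE cX.
Qed.

Lemma typ_mem H X : X \in H -> exists2 i, i \in typ H & #|X| = i.+1.
Proof.
move=> XH; have lt_X : #|X|.-1 < d by have := hset_card X; lia.
have e : #|X| = (Ordinal lt_X).+1 by have := hset_card X => /=; lia.
by exists (Ordinal lt_X) => //; apply/in_typ; exists X.
Qed.

Lemma inV i : (i \in V) = (i <= m).
Proof. by rewrite inE; have -> : d - 2 = m by lia. Qed.

Lemma wle_memV U U' i : wle V U' U -> i \in V -> i \in U -> i \in U'.
Proof.
move=> /wleP h iV iU; have [u uU' ui] := h i i iU iV.
by have -> : i = u by apply: val_inj; move: ui; clear; rewrite /=; lia.
Qed.

Lemma wle_sup U U' : U \subset U' -> wle V U' U.
Proof. by move=> /subsetP UU'; apply/wleP => u v /UU' uU' _; exists u => //; lia. Qed.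

Lemma wleV U : wle V V U.
Proof. by apply/wleP => u v _ vV; exists v => //; lia. Qed.

(** The only redundancy between levels is that d-2 hides d-1 from all the
    elements of [V]; any other level belongs to [V] and is seen by itself. *)
Lemma essentialE U :
  essential V U = (U != set0) && ~~ ((inord m \in U) && (ord_max \in U)).
Proof.
have mV : (inord m : 'I_d) \in V by rewrite inV inordK.
have V0 : V != set0 by apply/set0Pn; exists (inord m).
apply/idP/andP => [ess|[U0 top]].
  split; first by case/andP: ess.
  apply/negP => /andP[mU MU].
  have [v + iso] := essential_isolated V0 ess MU; rewrite inV => vm.
  have : inord m = ord_max :> 'I_d.
    by apply: iso => //; apply/orP; right; rewrite inordK //= vm leqnSn.
  by move/(congr1 val); rewrite /= inordK //; lia.
rewrite /essential U0; apply/forallP => U'; apply/implyP => /andP[U'0 /andP[U'U UU']].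
apply/subsetP => i iU; have [iV|] := boolP (i \in V).
  by move: iU; apply: wle_memV U'U iV.
rewrite inV => im; have iM : i = ord_max.
  exact: last_ord.
have [u uU'] := wleP _ _ _ U'U i _ iU mV; rewrite iM /= inordK // => um.
have [//|uM] := eqVneq u ord_max; first by move=> <-.
have u_le : u <= m by apply: contraNT uM => /last_ord->.
have {}uM : u = inord m.
  apply: val_inj; rewrite /= inordK //; apply/eqP; rewrite eqn_leq u_le.
  by case/orP: um => /andP[mu _] //; apply: leq_trans (leqnSn m) mu.
move: top; rewrite -iM iU andbT => /negP[].
by apply: wle_memV UU' mV _; rewrite -uM.
Qed.

Lemma typ_flag F : flag (F : {set K}).
Proof. by case/andP: (wflagP F). Qed.

Lemma typ_ess F : essential V (typ F).
Proof. by case/andP: (wflagP F). Qed.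

Lemma essential_supV U : essential V U -> V \subset U -> U = V.
Proof.
rewrite essentialE => /andP[_ top] /subsetP VU; apply/setP => i.
have [/VU->//|] := boolP (i \in V); rewrite inV => im.
have iM : i = ord_max by exact: last_ord.
by move: top; rewrite VU ?inV ?inordK //= -iM => /negPf.
Qed.

Lemma wythoffian_of_flag H : flag H -> essential V (typ H) -> exists F, wflag F = H.
Proof.
by move=> fH eH;
  exists (Wythoffian (hyperoctahedron_complex hd) (introT andP (conj fH eH))).
Qed.

Lemma wltE F G : (F < G)%O = wlt V (typ F) (typ G) && flag (wflag G :|: wflag F).
Proof. by []. Qed.

(** The type [V] is smaller than every type. Conversely a face of another
    type lies above the flag made of the faces of sizes at most d-1 of a maximal
    flag extending it. *)
Lemma dim_vertex F : (dim F == 0) = (typ F == V).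
Proof.
apply/idP/eqP => [|tF]; last first.
  by apply/eqP/dim_minimal => G; rewrite wltE /wlt tF wleV andbF.
apply: contraTeq => tF; have [M mM FM] := maxset_exists (typ_flag F).
have fM : flag M by case/maxsetP: mM.
pose H := [set X : K in M | #|X| < d].
have HM : H \subset M by apply/subsetP => X; rewrite inE => /andP[].
have tH : typ H = V.
  apply/setP => i; rewrite inV; apply/in_typ/idP => [[X]|im].
    by rewrite inE => /andP[_ + e]; rewrite e.
  have [|X XM cX] := @hflag_complete d M i.+1 mM; first by rewrite /= ltn_ord.
  by exists X => //; rewrite inE XM cX.
have [||G GH] := @wythoffian_of_flag H; first exact: hflagS fM.
  rewrite tH essentialE; apply/andP; split; last by rewrite !inV /= ltnn andbF.
  by apply/set0Pn; exists ord0; rewrite inV.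
have : (G < F)%O.
  rewrite wltE GH tH /wlt wleV /=; apply/andP; split.
    apply: contra tF => h; apply/eqP/essential_supV; first exact: typ_ess.
    by apply/subsetP => i iV; exact: (wle_memV h iV iV).
  by apply: hflagS fM; rewrite subUset FM HM.
by move/dim_lt; lia.
Qed.

(** Adjacency of two vertices at level [k]. At the last level the edge joining
    them carries a facet [Y], which has to contain both flags. *)
Definition differ_at (k : nat) (F G : {set K}) :=
  (forall X, #|X| != k -> (X \in F) = (X \in G)) /\
  (k = d.-1 -> exists2 Y : K, #|Y| = d &
     forall X, (X \in F) || (X \in G) -> hset X \subset hset Y).

(** The flag of an edge [e] is compatible with both vertices, so they share
    its faces of size at most d-1. If two levels of [V] were missing from [e],
    or if the last one were missing with no facet in its place, a face of the
    first vertex or a facet could be added to [e], giving an element strictly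
    between a vertex and [e]. *)
Lemma differ_at_of_edge F G e : typ F = V -> typ G = V -> dim e = 1 ->
  (F < e)%O -> (G < e)%O -> exists2 k, 0 < k < d & differ_at k F G.
Proof.
move=> tF tG de Fe Ge.
(* Nothing lies strictly between a vertex and an edge. *)
have mid H : flag H -> essential V (typ H) -> wlt V V (typ H) ->
    flag (H :|: wflag F) -> wlt V (typ H) (typ e) -> flag (wflag e :|: H) -> False.
  move=> fH eH; have [E <-] := wythoffian_of_flag fH eH => VE FE Ee eE.
  have /dim_lt : (F < E)%O by rewrite wltE tF VE.
  have /dim_lt : (E < e)%O by rewrite wltE Ee.
  by move: (dim E) (dim F) => a b; rewrite de; case: a.
have e_ess := typ_ess e.
move: (Fe) (Ge); rewrite !wltE tF tG => /andP[/andP[_ nwle] feF] /andP[_ feG].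
have [i iV iU] : exists2 i, i \in V & i \notin typ e.
  apply/subsetPn; apply: contra nwle; exact: wle_sup.
have im : i <= m by rewrite -inV.
have lev_F (A : W) j : typ A = V -> j \in V -> exists2 X, X \in wflag A & #|X| = j.+1.
  by move=> tA jV; apply/in_typ; rewrite tA.
have wltU j j' H : j \in V -> j' \in V -> j != j' -> j' \notin typ e ->
    typ H = j |: typ e -> wlt V V (typ H).
  move=> jV j'V jj' j'U ->; rewrite /wlt wleV; apply/negP => h.
  by have := wle_memV h j'V j'V; rewrite in_setU1 eq_sym (negPf jj') (negPf j'U).
have typ1 X H : typ (X |: H) = [set j : 'I_d | #|X| == j.+1] :|: typ H.
  apply/setP => j; apply/in_typ/setUP.
    move=> [Y /setU1P[->|YH] cY]; first by left; rewrite inE; apply/eqP.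
    by right; apply/in_typ; exists Y.
  move=> [|/in_typ[Y YH cY]]; first by rewrite inE => /eqP cX; exists X; rewrite ?setU11.
  by exists Y => //; rewrite setU1r.
have type1 X j : #|X| = j.+1 -> typ (X |: wflag e) = j |: typ e.
  move=> cX; rewrite typ1; congr (_ :|: _); apply/setP => j'.
  by rewrite !inE cX eqSS eq_sym.
have uniq j : j \in V -> j != i -> j \in typ e.
  move=> jV ji; apply: contraT => jU.
  (* Adding d-2 to a type that contains d-1 would not give an essential type;
     the other missing level is then the one to add. *)
  have [a [b [aV bV ab [aU bU top]]]] : exists a b, [/\ a \in V, b \in V, a != b
      & [/\ a \notin typ e, b \notin typ e & ord_max \in typ e -> a != inord m]].
    have [ji'|ne] := eqVneq i (inord m).
      by exists j, i; split=> //; split=> // _; rewrite -ji'.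
    by exists i, j; rewrite eq_sym.
  have [X XF cX] := lev_F F a tF aV.
  have tX := type1 X a cX.
  have sub : X |: wflag e \subset wflag e :|: wflag F.
    by rewrite subUset sub1set inE XF orbT subsetUl.
  case: (mid (X |: wflag e)) => //.
  - exact: hflagS feF.
  - rewrite tX essentialE; apply/andP; split.
      by apply/set0Pn; exists a; rewrite setU11.
    rewrite !in_setU1; move: e_ess top; rewrite essentialE => /andP[_].
    have -> : (ord_max == a) = false.
      by apply/negP => /eqP ea; move: aV; rewrite inV -ea ltnn.
    rewrite /= => h t; apply/negP => /andP[/orP[/eqP ea|mU] MU].
      by have := t MU; rewrite -ea eqxx.
    by rewrite mU MU in h.
  - exact: (wltU a b _ aV bV ab bU tX).
  - by apply: hflagS feF; rewrite subUset sub subsetUr.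
  - rewrite tX /wlt wle_sup ?subsetUr //=; apply: contra aU => h.
    by apply: wle_memV h aV _; rewrite setU11.
  - by apply: hflagS feF; rewrite subUset sub subsetUl.
exists i.+1; first by rewrite /= !ltnS.
split=> [X cX|[i_eq]].
  have half (A B : W) : typ A = V -> flag (wflag e :|: wflag A) ->
     typ B = V -> flag (wflag e :|: wflag B) -> X \in wflag A -> X \in wflag B.
    move=> tA feA tB feB XA; have [j + cj] := typ_mem XA; rewrite tA => jV.
    have /in_typ[Y Ye cY] : j \in typ e.
      by apply: uniq => //; apply: contra cX => /eqP<-; rewrite cj.
    have <- : Y = X.
      by apply: (hypercard_inj feA); rewrite ?inE ?Ye ?XA ?orbT // cY.
    have [Z ZB cZ] := lev_F B j tB jV.
    suff -> : Y = Z by [].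
    by apply: (hypercard_inj feB); rewrite ?inE ?Ye ?ZB ?orbT // cY.
  by apply/idP/idP; apply: half.
have top : ord_max \in typ e.
  apply: contraT => MU; have [M mM sM] := maxset_exists feF.
  have fM : flag M by case/maxsetP: mM.
  have [|Y YM cY] := @hflag_complete d M d mM; first by rewrite leqnn.
  have tY := type1 Y ord_max cY.
  have [eM FM] : wflag e \subset M /\ wflag F \subset M by move: sM; rewrite subUset => /andP.
  have sub : Y |: wflag e \subset M by rewrite subUset sub1set YM.
  have i_m : i = inord m by apply: val_inj; rewrite /= inordK // i_eq.
  have iM : i != ord_max by apply/eqP => iM; move: im; rewrite iM ltnn.
  case: (mid (Y |: wflag e)).
  - exact: hflagS fM.
  - rewrite tY essentialE; apply/andP; split.
      by apply/set0Pn; exists ord_max; rewrite setU11.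
    by rewrite !in_setU1 -i_m (negPf iM) (negPf iU).
  - rewrite tY /wlt wleV; apply/negP => h.
    by have := wle_memV h iV iV; rewrite in_setU1 (negPf iM) (negPf iU).
  - by apply: hflagS fM; rewrite subUset sub FM.
  - rewrite tY /wlt wle_sup ?subsetUr //=; apply/negP => h.
    have [u uU /= ui] := wleP _ _ _ h ord_max i (setU11 _ _) iV.
    have uM : u != ord_max by apply: contra MU => /eqP<-.
    have uni : u != i by apply: contra iU => /eqP<-.
    have um : u <= m by apply: contraNT uM => /last_ord->.
    case/negP: uni; rewrite -val_eqE /= eqn_leq i_eq um /=.
    by move: ui; rewrite i_eq => /orP[/andP[+ _]|/andP[]//]; apply: leq_trans.
  - by apply: hflagS fM; rewrite subUset sub eM.
have /in_typ[Y Ye cY] := top; exists Y => // X /orP[XF|XG].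
  apply: (hflag_sub feF); rewrite ?inE ?Ye ?XF ?orbT // cY.
  by have /andP[] := hset_card X.
apply: (hflag_sub feG); rewrite ?inE ?Ye ?XG ?orbT // cY.
by have /andP[] := hset_card X.
Qed.

(** A type that misses one level of [V], and replaces it by the facet level
    exactly when it is the last one, has only [V] strictly below it among the
    essential types. *)
Lemma edge_of_type F G H k : 0 < k < d -> typ F = V -> typ G = V ->
  flag (H :|: wflag F) -> flag (H :|: wflag G) ->
  (forall j, j \in V -> (j \in typ H) = (j.+1 != k)) ->
  (ord_max \in typ H) = (k == d.-1) ->
  exists2 e, dim e = 1 & (F < e)%O && (G < e)%O.
Proof.
move=> /andP[k0 kd] tF tG fF fG HV HM.
have mV : (inord m : 'I_d) \in V by rewrite inV inordK.
have Hm : (inord m \in typ H) = (k != d.-1).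
  by rewrite HV // inordK //= eq_sym.
have eH : essential V (typ H).
  rewrite essentialE Hm HM andNb andbT; apply/set0Pn.
  have [km|km] := boolP (k == d.-1); first by exists ord_max; rewrite HM.
  by exists (inord m); rewrite Hm.
have k1 : k.-1 < d by apply: leq_ltn_trans (leq_pred k) kd.
pose j : 'I_d := Ordinal k1.
have jk : j.+1 = k by rewrite /= prednK.
have jV : j \in V by rewrite inV -ltnS jk -ltnS.
have jH : j \notin typ H by rewrite HV // jk eqxx.
have Hlt : wlt V V (typ H).
  by rewrite /wlt wleV; apply: contra jH => h; apply: (wle_memV h jV jV).
have [e He] := wythoffian_of_flag (hflagS (subsetUl _ _) fF) eH.
have Fe : (F < e)%O by rewrite wltE tF He Hlt.
exists e; last by rewrite Fe wltE tG He Hlt.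
apply/eqP; rewrite eqn_leq; apply/andP; split; last first.
  by apply: leq_ltn_trans (dim_lt Fe).
apply: dim_le1 => B; rewrite wltE He => /andP[/andP[BH HB] _].
apply/eqP; rewrite dim_vertex; apply/eqP.
have [jB|jB] := boolP (j \in typ B).
  apply: essential_supV; first exact: typ_ess.
  apply/subsetP => i iV; have [->//|ij] := eqVneq i j.
  apply: (wle_memV BH iV); rewrite HV // -jk eqSS.
  by apply: contra ij => /eqP ij; apply/eqP/val_inj.
case/negP: HB; apply: wle_sup; apply/subsetP => i iB.
have [iV|iV] := boolP (i \in V).
  by rewrite HV // -jk eqSS; apply: contra jB => /eqP/val_inj<-.
have iM : i = ord_max by apply: last_ord; rewrite -inV.
rewrite iM HM; apply: contraT => km.
have mB : inord m \in typ B by apply: (wle_memV BH mV); rewrite Hm.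
by have := typ_ess B; rewrite essentialE mB -iM iB andbF.
Qed.

Lemma edge_of_differ_at F G k : 0 < k < d -> typ F = V -> typ G = V ->
  differ_at k F G -> exists2 e, dim e = 1 & (F < e)%O && (G < e)%O.
Proof.
move=> kd tF tG [FG FGY].
pose H := [set X : K in wflag F | #|X| != k].
have HF : H \subset wflag F by apply/subsetP => X; rewrite inE => /andP[].
have HG : H \subset wflag G.
  by apply/subsetP => X; rewrite inE => /andP[XF cX]; rewrite -FG.
have HU (A : {set K}) : H \subset A -> H :|: A = A by move/setUidPr.
have lev j : j \in V -> (j \in typ H) = (j.+1 != k).
  move=> jV; apply/in_typ/idP => [[X]|jk].
    by rewrite inE => /andP[_ cX] <-.
  have /in_typ[X XF cX] : j \in typ F by rewrite tF.
  by exists X => //; rewrite inE XF cX.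
have Fle X : X \in H -> #|X| < d.
  rewrite inE => /andP[XF _]; have [i + ->] := typ_mem XF.
  by rewrite tF inV.
have [km|km] := eqVneq k d.-1; last first.
  apply: (@edge_of_type F G H k) => //; rewrite ?HU ?typ_flag //.
  rewrite (negPf km); apply/negP => /in_typ[X /Fle cX eX].
  by rewrite eX ltnn in cX.
have [Y cY subY] := FGY km.
have fY (A : {set K}) : flag A -> (forall X, X \in A -> hset X \subset hset Y) -> flag (Y |: A).
  by move=> fA AY; apply: flagU1 => // X /AY XY; rewrite comparable_sym le_comparable.
have typY j : (j \in typ (Y |: H)) = (j == ord_max) || (j \in typ H).
  apply/in_typ/orP => [[X /setU1P[->|XH] cX]|[/eqP->|/in_typ[X XH cX]]].
  - by left; apply/eqP/val_inj; move: cX; rewrite cY => -[].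
  - by right; apply/in_typ; exists X.
  - by exists Y; rewrite ?setU11.
  - by exists X => //; rewrite setU1r.
apply: (@edge_of_type F G (Y |: H) k) => //.
- rewrite -setUA HU //; apply: fY; first exact: typ_flag.
  by move=> X XF; apply: subY; rewrite XF.
- rewrite -setUA HU //; apply: fY; first exact: typ_flag.
  by move=> X XG; apply: subY; rewrite XG orbT.
- move=> j jV; rewrite typY lev //; case: eqP => // jM.
  by move: jV; rewrite inV jM ltnn.
- by rewrite typY eqxx km eqxx.
Qed.

(** * The flag of a signed permutation *)

Local Notation spt := ('I_d * bool)%type.
Implicit Types (w u : {perm spt}) (p q : spt).

(** Positions carrying the [k] largest values. For [k < d] all the levels
    involved are positive, which makes the set signed; this is why the flags stop
    at size d-1. *)
Definition level w k : {set spt} := [set p | rk (w p) < k].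

Lemma in_level w k p : (p \in level w k) = (rk (w p) < k).
Proof. by rewrite inE. Qed.

Lemma card_level w k : k < d -> #|level w k| = k.
Proof.
move=> kd; rewrite -[RHS]card_ord -(card_codom (f := fun i : 'I_k => (w^-1)%g (pos m i))).
  apply: eq_card => p; rewrite in_level; apply/idP/codomP => [pk|[i ->]].
    by exists (Ordinal pk); rewrite /= -(rk_lt_pos kd pk) permK.
  rewrite permKV rk_pos //; have := ltn_ord i; lia.
move=> i j /perm_inj/(congr1 (@rk m)); have := ltn_ord i; have := ltn_ord j.
by move=> ? ?; rewrite !rk_pos; [move/val_inj|lia|lia].
Qed.

Lemma level_signed w k : k < d -> w \in Dgroup m -> signed (level w k).
Proof.
move=> kd wD; apply/forallP => i; rewrite !in_level.
rewrite -[(i, false)]/(negp (i, true)) Dgroup_negp //.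
by have := rk_negp (w (i, true)); lia.
Qed.

Lemma level_sub w k l : k <= l -> level w k \subset level w l.
Proof. by move=> kl; apply/subsetP => p; rewrite !in_level => /leq_trans; apply. Qed.

Lemma level_face w k : 0 < k < d -> w \in Dgroup m ->
  exists X : K, hset X = level w k.
Proof.
move=> /andP[k0 kd] wD; have h : (level w k != set0) && signed (level w k).
  by rewrite level_signed // -card_gt0 card_level // k0.
by exists (Hyperoctahedron h).
Qed.

Definition level_flag w : {set K} :=
  [set X : K | (#|X| < d) && (hset X == level w #|X|)].

Lemma level_flagP w X : reflect (#|X| < d /\ hset X = level w #|X|) (X \in level_flag w).
Proof. by rewrite inE; apply: (iffP andP) => -[? /eqP]. Qed.

Lemma level_flag_ex w k : w \in Dgroup m -> 0 < k < d ->
  exists X, [/\ X \in level_flag w, #|X| = k & hset X = level w k].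
Proof.
move=> wD kd; have [X hX] := level_face kd wD.
have cX : #|X| = k by rewrite hX card_level; case/andP: kd.
by exists X; split=> //; apply/level_flagP; rewrite cX hX; case/andP: kd.
Qed.

Lemma level_flag_flag w : flag (level_flag w).
Proof.
apply/flagP => X Y /level_flagP[_ hX] /level_flagP[_ hY].
have [XY|YX] := leqP #|X| #|Y|.
  by apply: le_comparable; rewrite hleE hX hY level_sub.
by rewrite comparable_sym; apply: le_comparable; rewrite hleE hX hY level_sub // ltnW.
Qed.

Lemma level_flag_typ w : w \in Dgroup m -> typ (level_flag w) = V.
Proof.
move=> wD; apply/setP => i; rewrite inV; apply/in_typ/idP.
  by move=> [X /level_flagP[+ _] e]; rewrite e.
move=> im; have [|X [XF cX _]] := @level_flag_ex w i.+1 wD; last by exists X.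
by rewrite /= !ltnS.
Qed.

Lemma essentialV : essential V V.
Proof.
rewrite essentialE; apply/andP; split; last by rewrite !inV /= ltnn andbF.
by apply/set0Pn; exists ord0; rewrite inV.
Qed.

Lemma level_flag_essential w : w \in Dgroup m ->
  flag (level_flag w) && essential V (typ (level_flag w)).
Proof. by move=> wD; rewrite level_flag_flag level_flag_typ // essentialV. Qed.

Lemma level_eqP w w' : w \in Dgroup m -> w' \in Dgroup m ->
  (forall k, 0 < k < d -> level w k = level w' k) -> w = w'.
Proof.
move=> wD w'D h; have uD : (w^-1 * w')%g \in Dgroup m by rewrite groupM ?groupV.
suff u1 : (w^-1 * w')%g = 1%g by rewrite -[RHS](mulKVg w) u1 mulg1.
apply: dominant_eq1 => // i; rewrite !(permM w^-1).
have [mP mQ] := rk_wall i; pose k := (rk (wall i).1).+1.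
have kd : 0 < k < d by rewrite /k mP /=; lia.
have inw p : (rk (w' (w^-1%g p)) < k) = (rk p < k).
  by rewrite -in_level -h // in_level permKV.
by have := inw (wall i).1; have := inw (wall i).2; rewrite mQ /k; lia.
Qed.

(** An even element bringing a given point to level [k]. When the point is
    the opposite of its target the sign change is paired with one of the last
    coordinate, available since [k <= d-2]. *)
Lemma rotate_to p k : k <= m -> k <= p.1 ->
  exists2 t, t \in Dgroup m &
    t p = pos m k /\ forall q : spt, q.1 < k -> t q = q.
Proof.
move=> km kp; have [pk|pk] := eqVneq p.1 (pos m k).1; last first.
  exists (sswap p (pos m k)); first exact: sswap_Dgroup.
  split=> [|q qk]; first exact: sswapL.
  by apply: sswap_id => //; rewrite -val_eqE /= ?inordK; lia.
have [->|->] := eq_fst_negp (esym pk).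
  by exists 1%g; rewrite ?group1 //; split=> [|q _]; rewrite perm1.
pose z := pos m m.+1; have kz : (pos m k).1 != z.1.
  by rewrite -val_eqE /= !inordK; lia.
have ok : (negp (pos m k)).1 != z.1 by [].
have zk : z.1 != (pos m k).1 by rewrite eq_sym.
exists (sswap (negp (pos m k)) z * sswap z (pos m k))%g; first by rewrite groupM ?sswap_Dgroup.
split=> [|q qk]; first by rewrite (permM (sswap _ _)) sswapL // sswapL.
have qk' : q.1 != (pos m k).1 by rewrite -val_eqE /= inordK; lia.
have qz : q.1 != z.1 by rewrite -val_eqE /= inordK; lia.
by rewrite (permM (sswap _ _)) sswap_id ?sswap_id.
Qed.

(** By induction on the size: once the faces of size at most [k] are level
    sets of [w], the next face adds one point, which [rotate_to] brings to level
    [k] without disturbing the earlier ones. *)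
Lemma level_flag_surj F : typ F = V ->
  exists2 w, w \in Dgroup m & wflag F = level_flag w.
Proof.
move=> tF; have fF := typ_flag F.
have lev k : 0 < k < d -> exists2 X, X \in wflag F & #|X| = k.
  case: k => // k /= kd; have /in_typ[X XF cX] : (Ordinal (ltnW kd)) \in typ F.
    by rewrite tF inV.
  by exists X.
have Fd X : X \in wflag F -> #|X| < d.
  by move=> XF; have [i + ->] := typ_mem XF; rewrite tF inV.
suff main k : k < d -> exists2 w, w \in Dgroup m &
    forall X, X \in wflag F -> #|X| <= k -> hset X = level w #|X|.
  have [w wD wF] := main m.+1 (leqnn _); exists w => //.
  apply/setP => X; apply/idP/level_flagP => [XF|[Xd hX]].
    by split; [exact: Fd | apply: wF => //; have := Fd _ XF].
  have [|Y YF cY] := lev #|X|; first by have := hset_card X; lia.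
  suff -> : X = Y by [].
  by apply: val_inj; rewrite /= hX -cY -wF // -ltnS cY.
elim: k => [|k IH] kd.
  exists 1%g => [|X _]; first exact: group1.
  by rewrite leqn0 => /eqP cX; have := hset_card X; rewrite cX.
have [w wD wF] := IH (ltnW kd).
have [|X XF cX] := lev k.+1; first by [].
have sX : signed X by case/andP: (hsetP X).
have LX : level w k \subset hset X.
  have [->|k0] := posnP k; first by apply/subsetP => p; rewrite in_level.
  have [|Y YF cY] := lev k; first by rewrite k0 ltnW.
  by rewrite -{1}cY -wF ?cY // (hflag_sub fF) // cX cY.
have cL : #|level w k| = k by apply: card_level; apply: ltnW.
have /properP[_ [f fX fL]] : level w k \proper hset X.
  by rewrite properEcard LX cL cX leqnn.
have ofX : negp f \notin hset X.
  apply: contraL sX => ofX; apply/negP => /forallP/(_ f.1).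
  by case: f fX ofX {fL} => i [] /= -> ->.
have wf : k <= (w f).1.
  have ofL : negp f \notin level w k by apply: contra ofX; apply: (subsetP LX).
  by move: fL ofL; rewrite !in_level Dgroup_negp // -!leqNgt; apply: le_rk_fst.
have [t tD [tf tid]] := @rotate_to (w f) k kd wf.
have wtL (j : nat) : j <= k -> level (w * t)%g j = level w j.
  move=> jk; have small q : rk q < j -> q.1 < k.
    by move=> qj; apply: leq_trans (rk_lt_fst (leq_ltn_trans jk (ltnW kd)) qj) jk.
  apply/setP => p; rewrite !in_level (permM w).
  apply/idP/idP => h; last by rewrite tid // small.
  by have /perm_inj <- := tid _ (small _ h).
exists (w * t)%g; first by rewrite groupM.
move=> Y YF; rewrite leq_eqVlt => /predU1P[cY|cY]; last first.
  by rewrite wtL //; apply: wF.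

have -> : Y = X by apply: (hypercard_inj fF) => //; rewrite cY cX.
rewrite cX; apply/eqP; rewrite eqEcard card_level // cX leqnn andbT.
have -> : hset X = f |: level w k.
  apply/esym/eqP; rewrite eqEcard cardsU1 fL cL cX leqnn andbT.
  by rewrite subUset sub1set fX.
rewrite subUset sub1set in_level (permM w) tf rk_pos ?ltnSn /=; last exact: ltnW.
by rewrite -wtL // level_sub.
Qed.
Local Notation P i := (wall i).1.
Local Notation Q i := (wall i).2.

(** A simple reflection moves a rank by at most one, so a point and its
    opposite cannot both have one of the first d-1 levels before or after it:
    the union of the two largest faces is signed and extends to a facet. *)
Lemma differ_at_srefl w i : w \in Dgroup m ->
  differ_at (rk (P i)).+1 (level_flag w) (level_flag (w * srefl i)%g).
Proof.
move=> wD; have wrD : (w * srefl i)%g \in Dgroup m by rewrite groupM ?srefl_Dgroup.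
have lev (j : nat) : j < d -> j != (rk (P i)).+1 -> level (w * srefl i)%g j = level w j.
  by move=> jd ji; apply/setP => p; rewrite !in_level (permM w) rk_srefl_lt.
split=> [X cX|km].
  by rewrite ![X \in _]inE; case: ltnP => //= Xd; rewrite lev.
pose A := level w m.+1 :|: level (w * srefl i)%g m.+1.
have sA : signed A.
  have sw1 := level_signed (ltnSn m.+1) wD; have sw2 := level_signed (ltnSn m.+1) wrD.
  have no (p : spt) : p \in level w m.+1 -> negp p \in level (w * srefl i)%g m.+1 -> False.
    rewrite !in_level (permM w) !Dgroup_negp ?srefl_Dgroup //.
    by have := rk_srefl_le i (w p); have := rk_negp (srefl i (w p)); lia.
  apply/forallP => j; apply/negP => /andP[/setUP[jt|jt] /setUP[jf|jf]].
  - by have /forallP/(_ j) := sw1; rewrite jt jf.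
  - exact: no jt jf.
  - exact: no jf jt.
  - by have /forallP/(_ j) := sw2; rewrite jt jf.
have [Y [AY sY cY]] := signed_extend sA.
have hY : (Y != set0) && signed Y by rewrite sY -card_gt0 cY.
exists (Hyperoctahedron hY) => // X XF; apply: subset_trans AY.
case/orP: XF => /level_flagP[Xd ->]; apply: (@subset_trans _ _ _).
- exact: (level_sub w (l := m.+1)).
- exact: subsetUl.
- exact: (level_sub _ (l := m.+1)).
- exact: subsetUr.
Qed.

(** Let [u] be the quotient of [w] and [w']. It preserves the first [j] levels
    for [j != k], so a simple root on which it is not dominant meets level [k].
    Composing with that reflection gives a dominant element, unless [k] is the
    last level and [u] reverses both branches of the diagram; then some
    point of the largest face of [w] has its opposite in the largest face of
    [w'], and no facet contains both. *)
Lemma srefl_of_differ_at w w' k : w \in Dgroup m -> w' \in Dgroup m -> w <> w' ->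
  0 < k < d -> differ_at k (level_flag w) (level_flag w') ->
  exists i, w' = (w * srefl i)%g.
Proof.
move=> wD w'D ww' kd [same top].
have lev (j : nat) : 0 < j < d -> j != k -> level w j = level w' j.
  move=> jd jk; have [X [XF cX <-]] := level_flag_ex wD jd.
  by move: XF; rewrite same ?cX // => /level_flagP[_ ->]; rewrite cX.
pose u := (w^-1 * w')%g; have uD : u \in Dgroup m by rewrite groupM ?groupV.
have w'E : w' = (w * u)%g by rewrite mulKVg.
have ulev (s : spt) (j : nat) : 0 < j < d -> j != k -> (rk (u s) < j) = (rk s < j).
  by move=> jd jk; rewrite (permM w^-1) -in_level -lev // in_level permKV.
have [|i lt_i] := descent uD.
  by apply/eqP => u1; apply: ww'; rewrite w'E u1 mulg1.
have rkd j : 0 < (rk (P j)).+1 < d by have [-> _] := rk_wall j; rewrite /=; lia.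
have ki : k = (rk (P i)).+1.
  apply/eqP; rewrite eq_sym; apply: contraLR lt_i => ik.
  have := ulev (P i) _ (rkd i) ik; have := ulev (Q i) _ (rkd i) ik.
  by have [_ ->] := rk_wall i; lia.
exists i; rewrite w'E; congr (w * _)%g.
suff v1 : (srefl i * u)%g = 1%g by rewrite -[LHS](mulKg (srefl i)) v1 mulg1 sreflV.
apply: dominant_eq1 => [|i']; first by rewrite groupM ?srefl_Dgroup.
rewrite !(permM (srefl i)).
have [kk|kk] := eqVneq (rk (P i')).+1 k; last first.
  have kki : (rk (P i')).+1 != (rk (P i)).+1 by rewrite -ki.
  have [_ i'd] := andP (rkd i').
  have inv s : (rk (u (srefl i s)) < (rk (P i')).+1) = (rk s < (rk (P i')).+1).
    by rewrite ulev // rk_srefl_lt.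
  have := inv (P i'); have := inv (Q i').
  by have [_ ->] := rk_wall i'; lia.
have [<-|[PP QQ]] : i = i' \/ (P i' = P i /\ Q i' = negp (Q i)).
  by apply: wall_same; apply: succn_inj; rewrite kk.
  by rewrite sreflL sreflR.
have km : k = m.+1.
  have [_ mQ] := rk_wall i; have [_ mQ'] := rk_wall i'.
  by move: mQ' (rk_negp (Q i)); rewrite PP QQ mQ ki; lia.
have [Y _ subY] := top km; have /andP[_ sY] := hsetP Y.
have inY p : (rk (w p) < m.+1) || (rk (w' p) < m.+1) -> p \in hset Y.
  have m1 : 0 < m.+1 < d by rewrite /= ltnSn.
  have [X [XF _ hX]] := level_flag_ex wD m1; have [X' [XF' _ hX']] := level_flag_ex w'D m1.
  rewrite -!in_level -hX -hX' => /orP[]; apply/subsetP/subY; by rewrite ?XF ?XF' ?orbT.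
have [p wp] : exists p, w p = P i by exists (w^-1%g (P i)); rewrite permKV.
have pY : p \in hset Y by apply: inY; move: km; rewrite wp ki => -[->]; rewrite ltnSn.
have : negp p \notin hset Y.
  apply: contraL sY => npY; apply/negP => /forallP/(_ p.1).
  by move: pY npY; rewrite /negp; case: (p) => a [] /= -> ->.
move/(contra (inY _)); rewrite negb_or w'E (permM w) !Dgroup_negp ?srefl_Dgroup //.
rewrite wp -leqNgt => /andP[_]; rewrite PP QQ Dgroup_negp ?srefl_Dgroup // sreflL sreflR.
rewrite Dgroup_negp //.
have := rk_negp (u (P i)); have := rk_negp (u (Q i)).
by move: (rk _) (rk _) (rk _) (rk _) lt_i => a b c e; lia.
Qed.
Theorem wythoffian_D_graph : exists2 f : vert (D_graph m) -> vert (skeleton W),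
  bijective f & forall x y, adj x y <-> adj (f x) (f y).
Proof.
pose g (w : vert (D_graph m)) : W :=
  Wythoffian (hyperoctahedron_complex hd) (level_flag_essential (valP w)).
have tg (w : vert (D_graph m)) : typ (g w) = V := level_flag_typ (valP w).
have gP (w : vert (D_graph m)) : dim (g w) == 0 by rewrite dim_vertex tg.
pose f (w : vert (D_graph m)) : vert (skeleton W) := exist (fun x : W => dim x == 0) (g w) (gP w).
have f_inj : injective f.
  move=> [w wD] [w' w'D] /(congr1 (fun x => wflag (val x))) /= ww'.
  apply: val_inj => /=; apply: level_eqP => // k kd.
  have [X [+ cX <-]] := level_flag_ex wD kd.
  by rewrite ww' => /level_flagP[_ ->]; rewrite cX.
exists f; first apply: bijective_of_surj => // [[F F0]].
  have /level_flag_surj[w wD FE] : typ F = V by apply/eqP; rewrite -dim_vertex.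
  by exists (D_vert wD); apply: val_inj; apply: val_inj; rewrite /= FE.
move=> x y; split=> [[i yE]|[xy [e de /andP[xe ye]]]].
  split.
    move=> /f_inj xy; have := srefl_neq1 i; rewrite -(mulKg (val x) (srefl i)) -yE xy.
    by rewrite mulVg eqxx.
  have kd : 0 < (rk (P i)).+1 < d by have [-> _] := rk_wall i; rewrite /=; lia.
  have := @edge_of_differ_at (g x) (g y) _ kd (tg x) (tg y).
  by rewrite /= yE => /(_ (differ_at_srefl _ (valP x)))[e de /andP[xe ye]]; exists e; rewrite ?xe.
have [k kd xyk] := differ_at_of_edge (tg x) (tg y) de xe ye.
apply: srefl_of_differ_at kd xyk; try exact: valP.
by move=> h; apply: xy; congr f; apply: val_inj.
Qed.
End WythoffianSkeleton.

(** * Scalar products and convex hulls *)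

Section Dot.
Local Open Scope ring_scope.
Variables (R : realType) (n : nat).
Implicit Types (x y z c : 'rV[R]_n).

Lemma dotC x y : dot x y = dot y x.
Proof. by apply: eq_bigr => i _; rewrite mulrC. Qed.

Lemma dotDr x y z : dot x (y + z) = dot x y + dot x z.
Proof. by rewrite /dot -big_split; apply: eq_bigr => i _; rewrite mxE mulrDr. Qed.

Lemma dotZr a x y : dot x (a *: y) = a * dot x y.
Proof. by rewrite /dot mulr_sumr; apply: eq_bigr => i _; rewrite mxE mulrCA. Qed.

Lemma dotNr x y : dot x (- y) = - dot x y.
Proof. by rewrite -scaleN1r dotZr mulN1r. Qed.

Lemma dotBr x y z : dot x (y - z) = dot x y - dot x z.
Proof. by rewrite dotDr dotNr. Qed.

Lemma dotDl x y z : dot (y + z) x = dot y x + dot z x.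
Proof. by rewrite !(dotC _ x) dotDr. Qed.

Lemma dotBl x y z : dot (y - z) x = dot y x - dot z x.
Proof. by rewrite !(dotC _ x) dotBr. Qed.

Lemma dotZl a x y : dot (a *: y) x = a * dot y x.
Proof. by rewrite !(dotC _ x) dotZr. Qed.

Lemma dot_sumr (I : finType) x (F : I -> 'rV[R]_n) :
  dot x (\sum_i F i) = \sum_i dot x (F i).
Proof.
elim/big_rec2: _ => [|i y z _ <-]; last by rewrite dotDr.
by rewrite -[0 in LHS](subrr x) dotBr subrr.
Qed.

Lemma dot_ge0 x : 0 <= dot x x.
Proof. by apply: sumr_ge0 => i _; rewrite -expr2 sqr_ge0. Qed.

Lemma dot_eq0 x : dot x x = 0 -> x = 0.
Proof.
move=> /psumr_eq0P x0; apply/rowP => i; rewrite mxE; apply/eqP.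
by rewrite -sqrf_eq0 expr2 x0 // => j _; rewrite -expr2 sqr_ge0.
Qed.

(** On a sphere, [dot x] is maximal at [x] only: the square of the distance is
    an affine function of the scalar product. *)
Lemma dot_sphere x y : dot x x = dot y y ->
  dot x y <= dot x x /\ (dot x y = dot x x -> y = x).
Proof.
move=> xy; have e : dot (x - y) (x - y) = 2 * (dot x x - dot x y).
  by rewrite dotBl !dotBr (dotC y x) -xy; ring.
split=> [|h]; first by have := dot_ge0 (x - y); rewrite e; lra.
by apply/esym/subr0_eq/dot_eq0; rewrite e h subrr mulr0.
Qed.

(** Both parameters are the nonzero root of the same quadratic equation. *)
Lemma line_sphere x t (a b : R) : dot (x + a *: t) (x + a *: t) = dot x x ->
  dot (x + b *: t) (x + b *: t) = dot x x ->
  a *: t != 0 -> b *: t != 0 -> a *: t = b *: t.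
Proof.
move=> ha hb a0 b0; suff -> : a = b by [].
have e s : dot (x + s *: t) (x + s *: t) =
    dot x x + s * (2 * dot x t + s * dot t t).
  by rewrite dotDl !dotDr !dotZl !dotZr (dotC t x); ring.
have [an0 t0] : a != 0 /\ t != 0.
  by split; apply: contraNneq a0 => ->; rewrite ?scale0r ?scaler0.
have bn0 : b != 0 by apply: contraNneq b0 => ->; rewrite scale0r.
have root s : s != 0 -> dot x x + s * (2 * dot x t + s * dot t t) = dot x x ->
    s * dot t t = - (2 * dot x t).
  move=> s0 h; have /eqP : s * (2 * dot x t + s * dot t t) = 0 by lra.
  by rewrite mulf_eq0 (negPf s0) /= => /eqP; lra.
have tt : dot t t != 0 by apply: contraNneq t0 => /dot_eq0->.
have ra : a * dot t t = - (2 * dot x t) by apply: root an0 _; rewrite -(e a).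
have rb : b * dot t t = - (2 * dot x t) by apply: root bn0 _; rewrite -(e b).
by apply: (mulIf tt); rewrite ra rb.
Qed.

Section Hull.
Import classical_sets convex interval_inference.
Local Open Scope classical_set_scope.
Implicit Types (A S : set 'rV[R]_n).

Lemma convexP S : (forall x y t, 0 <= t <= 1 -> S x -> S y ->
  S (t *: x + (1 - t) *: y)) -> @convex_set R 'rV[R]_n S.
Proof.
move=> h x y t /set_mem Sx /set_mem Sy; apply/mem_set.
apply: h => //; apply/andP; split; [exact: ge0|exact: le1].
Qed.

Lemma sub_hull A : A `<=` convex_hull A.
Proof. exact: sub_gen_smallest. Qed.

Lemma hull_sub A S : (forall x y t, 0 <= t <= 1 -> S x -> S y ->
  S (t *: x + (1 - t) *: y)) -> A `<=` S -> convex_hull A `<=` S.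
Proof. by move=> /convexP; apply: smallest_sub. Qed.

Lemma hull_convex A x y t : 0 <= t <= 1 -> convex_hull A x -> convex_hull A y ->
  convex_hull A (t *: x + (1 - t) *: y).
Proof.
move=> /andP[t0 t1] Ax Ay S [/= cS AS].
by apply/set_mem/(cS x y (Itv01 t0 t1)); apply/mem_set; [exact: Ax|exact: Ay].
Qed.

Lemma hull_le A c b : (forall x, A x -> dot c x <= b) ->
  forall x, convex_hull A x -> dot c x <= b.
Proof.
move=> Ab x; move: x; apply: hull_sub => // x y t /andP[t0 t1] /= xb yb.
by rewrite dotDr !dotZr; nra.
Qed.

(** The points strictly inside the half-space, together with the hull of the
    generators on its boundary, form a convex set containing every generator. *)
Lemma hull_face A c b : (forall x, A x -> dot c x <= b) ->
  forall x, convex_hull A x -> dot c x = b ->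
  convex_hull [set y | A y /\ dot c y = b] x.
Proof.
set B := [set y | _] => Ab x Ax.
have Bb y : convex_hull B y -> dot c y = b.
  move=> By; apply/eqP; rewrite eq_le; apply/andP; split.
    by apply: hull_le By => z [_ ->].
  have : dot (- c) y <= - b; last by rewrite -scaleN1r dotZl; lra.
  by apply: hull_le By => z [_ <-]; rewrite -scaleN1r dotZl; lra.
have : dot c x < b \/ convex_hull B x; last by case=> // + e; rewrite e ltxx.
move: x Ax; apply: hull_sub => [x y t /andP[t0 t1] hx hy|x Ax]; last first.
  have := Ab x Ax; rewrite le_eqVlt => /predU1P[e|]; last by left.
  by right; apply: sub_hull.
have [->|tn0] := eqVneq t 0; first by rewrite scale0r add0r subr0 scale1r.
have [->|tn1] := eqVneq t 1; first by rewrite subrr scale0r addr0 scale1r.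
have {}t0 : 0 < t by rewrite lt_neqAle eq_sym tn0.
have {}t1 : t < 1 by rewrite lt_neqAle tn1.
case: hx hy => [hx|hx] [hy|hy].
- by left; rewrite dotDr !dotZr; nra.
- by left; rewrite dotDr !dotZr (Bb y hy); nra.
- by left; rewrite dotDr !dotZr (Bb x hx); nra.
- by right; apply: hull_convex => //; rewrite !ltW.
Qed.

Lemma hull_nonempty A x : convex_hull A x -> exists y, A y.
Proof.
by move=> Ax; apply: boolp.contrapT => /boolp.forallNP nA; move: x Ax; apply: hull_sub.
Qed.

End Hull.
End Dot.

(** * The polytope of D_d *)

Section DPolytope.
Local Open Scope ring_scope.
Variables (R : realType) (m : nat).
Local Notation d := m.+2.
Local Notation spt := ('I_d * bool)%type.
Local Notation P i := (wall i).1.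
Local Notation Q i := (wall i).2.
Local Notation a := (@D_normal R d).
Implicit Types (x y c : 'rV[R]_d) (p q s : spt) (w u : {perm spt}) (i j : 'I_d).

(** The value of [x] on a signed coordinate. All of the geometry is written with
    [ext], on which the group acts by permuting the arguments. *)
Definition ext x p : R := if p.2 then x 0 p.1 else - x 0 p.1.

Lemma ext_negp x p : ext x (negp p) = - ext x p.
Proof. by case: p => i [] //=; rewrite /ext /= opprK. Qed.

Lemma ext_inj x y : ext x =1 ext y -> x = y.
Proof. by move=> xy; apply/rowP => i; apply: (xy (i, true)). Qed.

Lemma extD x y p : ext (x + y) p = ext x p + ext y p.
Proof. by rewrite /ext !mxE opprD; case: ifP. Qed.

Lemma extZ k x p : ext (k *: x) p = k * ext x p.
Proof. by rewrite /ext !mxE; case: ifP; rewrite ?mulrN. Qed.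

Lemma extN x p : ext (- x) p = - ext x p.
Proof. by rewrite -scaleN1r extZ mulN1r. Qed.

Definition act w x : 'rV[R]_d := \row_i ext x (w (i, true)).

Lemma ext_act w x p : w \in Dgroup m -> ext (act w x) p = ext x (w p).
Proof.
move=> wD; case: p => i [] /=; first by rewrite {1}/ext mxE.
by rewrite -[(i, false)]/(negp (i, true)) Dgroup_negp // !ext_negp {1}/ext mxE.
Qed.

Lemma actM w u x : w \in Dgroup m -> u \in Dgroup m ->
  act w (act u x) = act (w * u)%g x.
Proof. by move=> wD uD; apply/rowP => i; rewrite !mxE ext_act // (permM w). Qed.

Lemma act1 x : act 1%g x = x.
Proof. by apply: ext_inj => p; rewrite ext_act ?group1 // perm1. Qed.

Lemma actD w x y : act w (x + y) = act w x + act w y.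
Proof. by apply/rowP => i; rewrite !mxE extD. Qed.

Lemma actZ w k x : act w (k *: x) = k *: act w x.
Proof. by apply/rowP => i; rewrite !mxE extZ. Qed.

Lemma actB w x y : act w (x - y) = act w x - act w y.
Proof. by rewrite actD -scaleN1r actZ scaleN1r. Qed.

Lemma act_sum w (I : finType) (F : I -> 'rV[R]_d) :
  act w (\sum_i F i) = \sum_i act w (F i).
Proof.
elim/big_rec2: _ => [|i y z _ <-]; last by rewrite actD.
by rewrite -[0 in LHS](subrr (0 : 'rV_d)) actB subrr.
Qed.

Lemma dot_ext x y : 2 * dot x y = \sum_p ext x p * ext y p.
Proof.
rewrite -(pair_bigA _ (fun i b => ext x (i, b) * ext y (i, b))) /= /dot mulr_sumr.
by apply: eq_bigr => i _; rewrite big_bool /ext /= mulrNN; ring.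
Qed.

Lemma dot_act w x y : w \in Dgroup m -> dot (act w x) (act w y) = dot x y.
Proof.
move=> wD; have two : (2 : R) != 0 by rewrite pnatr_eq0.
apply: (mulfI two); rewrite !dot_ext [RHS](reindex_inj (@perm_inj _ w)).
by apply: eq_bigr => p _; rewrite !ext_act.
Qed.

Definition base p : 'rV[R]_d := \row_j ((j == p.1)%:R * (-1) ^+ ~~ p.2).

Lemma dot_base p x : dot (base p) x = ext x p.
Proof.
rewrite /dot (bigD1 p.1) //= big1 => [|j jp]; last by rewrite mxE (negPf jp) !mul0r.
by rewrite mxE eqxx mul1r addr0 /ext; case: p.2; rewrite /= ?expr0 ?expr1 ?mul1r ?mulN1r.
Qed.

Lemma ext_base p s : ext (base p) s = (s == p)%:R - (s == negp p)%:R.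
Proof.
rewrite /ext mxE; case: p s => i b [j e]; rewrite /= !xpair_eqE /=.
by case: (j == i); case: b; case: e; rewrite /= ?mul0r ?mul1r ?expr0 ?expr1; ring.
Qed.

Lemma normalE i : a i = base (P i) - base (Q i).
Proof.
apply/rowP => j; rewrite !mxE /wall; case: ifP => id /=.
  by rewrite !mulr1 -!val_eqE /= inordK.
have im : i = m.+1 :> nat by have := ltn_ord i; lia.
rewrite -!val_eqE /= inordK // expr0 expr1 mulr1 mulrN1 opprK.
by congr (_%:R + _%:R).
Qed.

Lemma dot_normal i x : dot (a i) x = ext x (P i) - ext x (Q i).
Proof. by rewrite normalE dotBl !dot_base. Qed.

Lemma ext_normal i s : ext (a i) s =
  (s == P i)%:R - (s == negp (P i))%:R - ((s == Q i)%:R - (s == negp (Q i))%:R).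
Proof. by rewrite normalE extD extN !ext_base. Qed.

Lemma wall_neq i : [/\ P i == Q i = false, P i == negp (Q i) = false,
   Q i == negp (P i) = false & negp (P i) == negp (Q i) = false].
Proof.
have nPQ := wall_fst i.
by split; apply/negP => /eqP/(congr1 fst)/= e; rewrite e eqxx in nPQ.
Qed.

Lemma ext_normal_wall i : ext (a i) (P i) = 1 /\ ext (a i) (Q i) = -1.
Proof.
have [n1 n2 n3 n4] := wall_neq i.
rewrite !ext_normal !eqxx [_ == P i]eq_sym n1 n2 n3 ![_ == negp _]eq_sym.
by rewrite !(negPf (negp_neq _)) /=; split; ring.
Qed.

Lemma dot_normal2 i : dot (a i) (a i) = 2.
Proof. by rewrite dot_normal; have [-> ->] := ext_normal_wall i; ring. Qed.

Lemma act_srefl i x : act (srefl i) x = x - dot (a i) x *: a i.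
Proof.
have ri := srefl_Dgroup i; have [n1 n2] := ext_normal_wall i.
have ro s : srefl i (negp s) = negp (srefl i s) by apply: Dgroup_negp.
apply: ext_inj => s; rewrite ext_act // extD extN extZ dot_normal.
have [[]->|[-> s1 s2 s3 s4]] := srefl_cases i s.
- by rewrite sreflL n1; ring.
- by rewrite sreflR n2; ring.
- by rewrite ro sreflL !ext_negp n1; ring.
- by rewrite ro sreflR !ext_negp n2; ring.
- rewrite ext_normal.
  have ne p : rk s != rk p -> (s == p) = false by move=> h; apply: contraNF h => /eqP->.
  by rewrite !ne //=; ring.
Qed.

Lemma reflection_act i x : reflection (a i) x = act (srefl i) x.
Proof.
have two : (2 : R) != 0 by rewrite pnatr_eq0.
by rewrite /reflection dot_normal2 act_srefl mulrAC mulfV // mul1r.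
Qed.

Lemma reflection_group_act (l : seq 'I_d) : exists2 w, w \in Dgroup m &
  foldr (fun i h => reflection (a i) \o h) idfun l =1 act w.
Proof.
elim: l => [|i l [w wD IH]] /=; first by exists 1%g => [|x]; rewrite ?group1 ?act1.
exists (srefl i * w)%g => [|x]; first by rewrite groupM ?srefl_Dgroup.
by rewrite /= IH reflection_act actM ?srefl_Dgroup.
Qed.

Section Orbit.
Variable v : 'rV[R]_d.
Hypothesis v_pos : forall i, 0 < dot (a i) v.

Lemma ext_pos_succ k : (k <= m)%N -> ext v (pos m k.+1) < ext v (pos m k).
Proof. by move=> km; have := v_pos (inord k); rewrite dot_normal wall_inord //= subr_gt0. Qed.

Lemma ext_mono k l : (k < l <= m.+1)%N -> ext v (pos m l) < ext v (pos m k).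
Proof.
elim: l => // l IH; rewrite ltnS leq_eqVlt => /andP[/predU1P[->|kl] lm].
  exact: ext_pos_succ.
by apply: lt_trans (ext_pos_succ _) (IH _) => //; rewrite kl ltnW.
Qed.

Lemma ext_top : - ext v (pos m m.+1) < ext v (pos m m).
Proof. by have := v_pos ord_max; rewrite dot_normal wall_max /= ext_negp subr_gt0. Qed.

Lemma ext_gt0 k : (k <= m)%N -> 0 < ext v (pos m k).
Proof.
move=> km; have m0 : 0 < ext v (pos m m).
  by have := ext_top; have := ext_pos_succ (leqnn m); lra.
have [->//|nkm] := eqVneq k m; apply: lt_trans m0 (ext_mono _).
by rewrite ltn_neqAle nkm km leqnSn.
Qed.

Lemma ext_add k l : (k <= m.+1)%N -> (l <= m.+1)%N -> k != l ->
  - ext v (pos m l) < ext v (pos m k).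
Proof.
wlog kl : k l / (k < l)%N.
  move=> th km lm nkl; have [kl|lk|e] := ltngtP k l; first exact: th.
    by rewrite -ltrN2 opprK th // eq_sym.
  by rewrite e eqxx in nkl.
move=> km lm _; have {km}km : (k <= m)%N by rewrite -ltnS (leq_trans kl).
have [lm'|lm'] := leqP l m; first by have := ext_gt0 km; have := ext_gt0 lm'; lra.
have -> : l = m.+1 by apply/eqP; rewrite eqn_leq lm.
apply: lt_le_trans ext_top _; have [->//|nkm] := eqVneq k m.
by apply/ltW/ext_mono; rewrite ltn_neqAle nkm km leqnSn.
Qed.

(** The simple roots order the values with sign [+] in a chain; comparisons
    between opposite signs hold because all these values but the last are
    positive, and larger than the last in absolute value. *)
Lemma ext_lt p q : p.1 != q.1 -> (ext v q < ext v p) = (rk p < rk q)%N.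
Proof.
have half p' q' : p'.1 != q'.1 -> (rk p' < rk q')%N -> ext v q' < ext v p'.
  case: p' q' => [i b] [j e]; rewrite -val_eqE /= => ij.
  have neg k : (k, false) = negp (k, true) :> spt by [].
  have li := ltn_ord i; have lj := ltn_ord j.
  case: b; case: e; rewrite ?neg ?ext_negp !pos_ord /rk /= ?inord_val => lt_pq.
  - by apply: ext_mono; rewrite lt_pq -ltnS.
  - exact: ext_add.
  - by exfalso; lia.
  - by rewrite ltrN2; apply: ext_mono; rewrite -(ltnS i) li andbT; lia.
move=> pq; apply/idP/idP; last exact: half.
move=> lt_qp; rewrite ltnNge leq_eqVlt; apply/negP => /orP[/eqP e|].
  by have := rk_neq pq; rewrite e eqxx.
by move/half; rewrite eq_sym => /(_ pq)/lt_trans/(_ lt_qp); rewrite ltxx.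
Qed.

Definition orbit_pt w := act w v.

Lemma orbit_pt_inj : {in Dgroup m &, injective orbit_pt}.
Proof.
move=> w u wD uD wu; have kD : (w^-1 * u)%g \in Dgroup m by rewrite groupM ?groupV.
suff k1 : (w^-1 * u)%g = 1%g by rewrite -[RHS](mulKVg w) k1 mulg1.
have e p : ext v ((w^-1 * u)%g p) = ext v p.
  by rewrite (permM w^-1) -ext_act // -/(orbit_pt u) -wu ext_act // permKV.
apply: dominant_eq1 => // i; rewrite -ext_lt ?Dgroup_fst ?wall_fst // !e.
by rewrite ext_lt ?wall_fst // wall_lt.
Qed.

(** A simple reflection applied to a point of the orbit on the wrong side of
    its wall increases the scalar product with [v], and the orbit is finite; the
    process stops at [v] only. *)
Lemma Dgroup_ind (Pr : {perm spt} -> Prop) : Pr 1%g ->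
  (forall w i, w \in Dgroup m -> dot (a i) (orbit_pt w) < 0 -> Pr (srefl i * w)%g -> Pr w) ->
  forall w, w \in Dgroup m -> Pr w.
Proof.
move=> Pr1 step w wD.
pose A w := [set u in Dgroup m | dot v (orbit_pt w) < dot v (orbit_pt u)].
(* The measure is the number of points of the orbit higher than [w]. *)
have [k] := ubnP #|A w|; elim: k w wD => // k IH w wD Ak.
have [->//|w1] := eqVneq w 1%g; have [i lt_i] := descent wD w1.
have neg : dot (a i) (orbit_pt w) < 0.
  by rewrite dot_normal subr_lt0 !ext_act // ext_lt // Dgroup_fst // eq_sym wall_fst.
have rwD : (srefl i * w)%g \in Dgroup m by rewrite groupM ?srefl_Dgroup.
have inc : dot v (orbit_pt w) < dot v (orbit_pt (srefl i * w)%g).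
  rewrite {2}/orbit_pt -actM ?srefl_Dgroup // act_srefl dotBr dotZr (dotC v (a i)).
  by have := v_pos i; nra.
apply: (step w i) => //; apply: IH => //.
rewrite ltnS in Ak; apply: leq_trans Ak; apply/proper_card/properP; split.
  by apply/subsetP => u; rewrite !inE => /andP[-> /(lt_trans inc)].
by exists (srefl i * w)%g; rewrite inE ?ltxx ?andbF // rwD.
Qed.

Lemma reflection_group_surj w : w \in Dgroup m ->
  exists l, foldr (fun i h => reflection (a i) \o h) idfun l =1 act w.
Proof.
move: w; apply: Dgroup_ind => [|w i wD _ [l IH]]; first by exists [::] => x; rewrite act1.
have rD := srefl_Dgroup i; have rwD : (srefl i * w)%g \in Dgroup m by rewrite groupM.
by exists (i :: l) => x /=; rewrite IH reflection_act actM // mulgA sreflK mul1g.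
Qed.

(** Along the process of [Dgroup_ind] each step adds a positive multiple of a
    simple root. *)
Lemma dominance w : w \in Dgroup m ->
  exists2 l : 'I_d -> R, forall i, 0 <= l i & v - orbit_pt w = \sum_i l i *: a i.
Proof.
move: w; apply: Dgroup_ind => [|w i wD neg [l l0 e]].
  exists (fun _ => 0) => //; rewrite /orbit_pt act1 subrr.
  by rewrite big1 // => i _; rewrite scale0r.
exists (fun j => l j + (j == i)%:R * - dot (a i) (orbit_pt w)) => [j|].
  by rewrite addr_ge0 // mulr_ge0 ?ler0n //; lra.
under eq_bigr do rewrite scalerDl.
rewrite big_split /= -e /orbit_pt -actM ?srefl_Dgroup // act_srefl (bigD1 i) //= eqxx mul1r big1.
  by rewrite addr0 scaleNr opprB addrA addrAC addrK.
by move=> j /negPf ->; rewrite mul0r scale0r.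
Qed.

Lemma dominance_at w u : w \in Dgroup m -> u \in Dgroup m ->
  exists2 l : 'I_d -> R, forall i, 0 <= l i &
    orbit_pt w - orbit_pt u = \sum_i l i *: act w (a i).
Proof.
move=> wD uD; have [|l l0 e] := @dominance (w^-1 * u)%g; first by rewrite groupM ?groupV.
exists l => //; transitivity (act w (v - orbit_pt (w^-1 * u)%g)).
  by rewrite actB /orbit_pt actM ?groupM ?groupV // mulKVg.
by rewrite e act_sum; apply: eq_bigr => i _; rewrite actZ.
Qed.

Lemma orbit_pt_srefl w i : w \in Dgroup m ->
  orbit_pt (w * srefl i)%g = orbit_pt w - dot (a i) v *: act w (a i).
Proof. by move=> wD; rewrite /orbit_pt -actM ?srefl_Dgroup // act_srefl actB actZ. Qed.

Lemma orbit_pt_norm w u : w \in Dgroup m -> u \in Dgroup m ->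
  dot (orbit_pt w) (orbit_pt w) = dot (orbit_pt u) (orbit_pt u).
Proof. by move=> wD uD; rewrite !dot_act. Qed.

Lemma orbit_pt_line w u1 u2 (t : 'rV[R]_d) (k1 k2 : R) :
  w \in Dgroup m -> u1 \in Dgroup m -> u2 \in Dgroup m ->
  orbit_pt u1 = orbit_pt w + k1 *: t -> orbit_pt u2 = orbit_pt w + k2 *: t ->
  orbit_pt u1 <> orbit_pt w -> orbit_pt u2 <> orbit_pt w -> orbit_pt u1 = orbit_pt u2.
Proof.
move=> wD u1D u2D e1 e2 n1 n2; rewrite e1 e2; congr (_ + _).
apply: (@line_sphere _ _ (orbit_pt w)); rewrite -?e1 -?e2; try exact: orbit_pt_norm.
  by apply/eqP => h; apply: n1; rewrite e1 h addr0.
by apply/eqP => h; apply: n2; rewrite e2 h addr0.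
Qed.

Lemma same_root_wall i j : same_root (P i) (Q i) (P j) (Q j) -> i = j.
Proof.
have [mi qi] := rk_wall i; have [mj qj] := rk_wall j.
have oP := rk_negp (P i); have oQ := rk_negp (Q i).
case/orP => [/orP[]|/orP[]] /eqP[e1 e2].
- case: (wall_same (congr1 (@rk m) (esym e1))) => // -[_ e].
  by have := negp_neq (Q i); rewrite -e e2 eqxx.
- by move: qj; rewrite e1 e2 qi; lia.
- by move: qj; rewrite e1 e2; lia.
- by move: mj qj; rewrite e1 e2; lia.
Qed.

Lemma normal_srefl_gt0 i j : i != j -> 0 < dot (a j) (act (srefl i) v).
Proof.
move=> ij; rewrite dot_normal subr_gt0 !ext_act ?srefl_Dgroup //.
rewrite ext_lt ?(Dgroup_fst _ _ (srefl_Dgroup i)) ?wall_fst // srefl_lt ?wall_fst // wall_lt /=.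
by apply: contra ij => /same_root_wall->.
Qed.

Section Faces.
Import classical_sets.
Local Open Scope classical_set_scope.
Local Notation Pol := (wythoff_polytope a v).
Local Notation orbit := [set g v | g in reflection_group a].

Lemma orbitP x : orbit x <-> exists2 w, w \in Dgroup m & x = orbit_pt w.
Proof.
split=> [[g [l ->] <-]|[w wD ->]].
  by have [w wD e] := reflection_group_act l; exists w; rewrite ?e.
have [l e] := reflection_group_surj wD.
by exists (foldr (fun i h => reflection (a i) \o h) idfun l); [exists l|rewrite e].
Qed.

Lemma orbit_pt_Pol w : w \in Dgroup m -> Pol (orbit_pt w).
Proof. by move=> wD; apply: sub_hull; apply/orbitP; exists w. Qed.

Lemma Pol_face c b z : (forall w, w \in Dgroup m -> dot c (orbit_pt w) <= b) ->
  Pol z -> dot c z = b ->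
  convex_hull [set y | exists2 w, w \in Dgroup m & y = orbit_pt w /\ dot c y = b] z.
Proof.
move=> cb Pz cz; have cb' y : orbit y -> dot c y <= b by move=> /orbitP[w wD ->]; apply: cb.
have := hull_face cb' Pz cz; apply: hull_sub => [x y t|y [/orbitP[w wD yE] cy]].
  exact: hull_convex.
by apply: sub_hull; exists w.
Qed.

Lemma Pol_le c b z : (forall w, w \in Dgroup m -> dot c (orbit_pt w) <= b) ->
  Pol z -> dot c z <= b.
Proof. by move=> cb; apply: hull_le => y /orbitP[w wD ->]; apply: cb. Qed.

(** All points of the orbit lie on a sphere, so the form [dot x] singles out
    [x] among them. Conversely an exposed point is itself a generator, by
    [hull_face]. *)
Lemma vertexP x : vertices Pol x <-> exists2 w, w \in Dgroup m & x = orbit_pt w.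
Proof.
split=> [[c [b [cb /seteqP[sub sup]]]]|[w wD ->]].
  have [Px cx] := sub x erefl.
  have cb' w : w \in Dgroup m -> dot c (orbit_pt w) <= b.
    by move=> wD; apply: cb; apply: orbit_pt_Pol.
  have [_ [w wD [-> cw]]] := hull_nonempty (Pol_face cb' Px cx).
  by exists w => //; apply/esym/sup; split=> //; apply: orbit_pt_Pol.
have b u : u \in Dgroup m -> dot (orbit_pt w) (orbit_pt u) <= dot (orbit_pt w) (orbit_pt w).
  by move=> uD; have [] := dot_sphere (orbit_pt_norm wD uD).
exists (orbit_pt w), (dot (orbit_pt w) (orbit_pt w)); split; first by move=> z; apply: Pol_le.
apply/seteqP; split=> [_ ->|y [Py wy]] /=; first by split=> //; apply: orbit_pt_Pol.
have := Pol_face b Py wy.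
apply: (hull_sub (S := [set orbit_pt w])) => [z1 z2 t _ -> ->|z [u uD [-> e]]].
  by rewrite -scalerDl addrCA subrr addr0 scale1r.
by have [_ ->] := dot_sphere (orbit_pt_norm wD uD).
Qed.

(** The form [c] is the sum of the two ends. On the simple roots of the chamber
    of [w] it is nonnegative and vanishes on the root [i] only, so by dominance
    its maximum is attained only on the line through the two ends, on which the
    orbit has no other point. *)
Lemma srefl_edge w i : w \in Dgroup m -> exists2 e,
  is_face Pol e /\ has_affine_dim 1 e & e (orbit_pt w) /\ e (orbit_pt (w * srefl i)%g).
Proof.
move=> wD; have rD := srefl_Dgroup i.
have wrD : (w * srefl i)%g \in Dgroup m by rewrite groupM.
pose c := orbit_pt w + orbit_pt (w * srefl i)%g; pose b := dot c (orbit_pt w).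
have cj j : dot c (act w (a j)) = dot (a j) v + dot (a j) (act (srefl i) v).
  by rewrite /c dotDl /orbit_pt -(actM _ wD rD) !dot_act // !(dotC _ (a j)).
have c0 : dot c (act w (a i)) = 0.
  by rewrite cj act_srefl dotBr dotZr dot_normal2; ring.
have cpos j : i != j -> 0 < dot c (act w (a j)).
  by move=> ij; rewrite cj addr_gt0 ?v_pos // normal_srefl_gt0.
have cge0 j : 0 <= dot c (act w (a j)).
  by have [<-|/cpos/ltW//] := eqVneq i j; rewrite c0.
have key u : u \in Dgroup m -> dot c (orbit_pt u) <= b /\
    (dot c (orbit_pt u) = b -> orbit_pt u = orbit_pt w \/ orbit_pt u = orbit_pt (w * srefl i)%g).
  move=> uD; have [l l0 e] := dominance_at wD uD.
  have bE : b - dot c (orbit_pt u) = \sum_j l j * dot c (act w (a j)).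
    by rewrite -dotBr e dot_sumr; apply: eq_bigr => j _; rewrite dotZr.
  have t0 j : 0 <= l j * dot c (act w (a j)) by rewrite mulr_ge0.
  split; first by rewrite -subr_ge0 bE sumr_ge0.
  move=> eqb; move: bE; rewrite eqb subrr => /esym/psumr_eq0P s0.
  have lj0 j : j != i -> l j = 0.
    move=> ji; have /eqP := s0 (fun j _ => t0 j) j isT.
    by rewrite mulf_eq0 (gt_eqF (cpos _ _)) 1?eq_sym // orbF => /eqP.
  have uE : orbit_pt u = orbit_pt w + (- l i) *: act w (a i).
    rewrite scaleNr; apply/esym/eqP; rewrite subr_eq addrC -subr_eq e.
    rewrite (bigD1 i) //= big1 ?addr0 // => j /lj0->.
    by rewrite scale0r.
  have wrE : orbit_pt (w * srefl i)%g = orbit_pt w + (- dot (a i) v) *: act w (a i).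
    by rewrite orbit_pt_srefl // scaleNr.
  have [->|/eqP uw] := eqVneq (orbit_pt u) (orbit_pt w); [by left|right].
  apply: (orbit_pt_line wD uD wrD uE wrE) => // /(orbit_pt_inj wrD wD) h.
  have := wall_fst i; rewrite -(sreflL i) -[srefl i](mulKg w) h mulVg perm1 eqxx //.
have cwr : dot c (orbit_pt (w * srefl i)%g) = b.
  by rewrite orbit_pt_srefl // dotBr dotZr c0 mulr0 subr0.
have key1 u uD := (key u uD).1.
exists [set z | Pol z /\ dot c z = b]; last by split; split=> //; apply: orbit_pt_Pol.
split; first by exists c, b; split=> // z; apply: Pol_le.
have nz : orbit_pt (w * srefl i)%g - orbit_pt w != 0.
  rewrite subr_eq0; apply/eqP => /(orbit_pt_inj wrD wD) h.
  by have := wall_fst i; rewrite -(sreflL i) -[srefl i](mulKg w) h mulVg perm1 eqxx.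
exists (orbit_pt w), (orbit_pt (w * srefl i)%g - orbit_pt w); split.
- by rewrite /row_free rank_rV nz.
- by split=> //; apply: orbit_pt_Pol.
- by move=> k; rewrite row_id addrC subrK; split=> //; apply: orbit_pt_Pol.
move=> z [Pz cz]; have := Pol_face key1 Pz cz.
pose S := [set z | (z - orbit_pt w <= orbit_pt (w * srefl i)%g - orbit_pt w)%MS].
apply: (hull_sub (S := S)) => [x y t _ /= xs ys|y [u uD [-> /(key u uD).2 h]]];
  rewrite /S /=.
  have -> : t *: x + (1 - t) *: y - orbit_pt w =
    t *: (x - orbit_pt w) + (1 - t) *: (y - orbit_pt w).
    rewrite !scalerBr addrACA -opprD -scalerDl.
    by rewrite [t + _]addrCA subrr addr0 scale1r.
  by rewrite addmx_sub // scalemx_sub.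
by case: h => ->; rewrite ?subrr ?sub0mx.
Qed.

(** The form defining the edge is maximal at [w], hence nonnegative on the
    simple roots of its chamber, and it vanishes on the combination of them that
    leads to [u]. A root [i] with a nonzero coefficient therefore lies along the
    face, and the neighbour of [w] across the wall [i] lies on it; being on the
    same line and sphere as [w] and [u], it is [u]. *)
Lemma edge_srefl w u e : w \in Dgroup m -> u \in Dgroup m -> w != u ->
  is_face Pol e -> has_affine_dim 1 e -> e (orbit_pt w) -> e (orbit_pt u) ->
  exists i, u = (w * srefl i)%g.
Proof.
move=> wD uD wu [c [b [cb eE]]] [p [A [_ _ _ eA]]] ew eu.
have eq_e z : e z <-> Pol z /\ dot c z = b by rewrite eE.
have [_ cw] := (eq_e _).1 ew; have [_ cu] := (eq_e _).1 eu.
have nwu : orbit_pt u <> orbit_pt w by move=> /(orbit_pt_inj uD wD) e'; rewrite e' eqxx in wu.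
have [l l0 diff] := dominance_at wD uD.
have ca j : 0 <= dot c (act w (a j)).
  have wrD : (w * srefl j)%g \in Dgroup m by rewrite groupM ?srefl_Dgroup.
  have := cb _ (orbit_pt_Pol wrD); rewrite orbit_pt_srefl // dotBr dotZr cw.
  by have := v_pos j; nra.
have /esym/psumr_eq0P s0 : 0 = \sum_j l j * dot c (act w (a j)).
  rewrite -[LHS](subrr b) -{1}cw -cu -dotBr diff dot_sumr.
  by apply: eq_bigr => j _; rewrite dotZr.
have [i li] : exists i, l i != 0.
  apply/existsP; apply: contra_notT nwu; rewrite negb_exists => /forallP l_0.
  apply/esym/subr0_eq; rewrite diff big1 // => j _.
  by have := l_0 j; rewrite negbK => /eqP->; rewrite scale0r.
have ci : dot c (act w (a i)) = 0.
  have /eqP := s0 (fun j _ => mulr_ge0 (l0 j) (ca j)) i isT.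
  by rewrite mulf_eq0 (negPf li) => /eqP.
have wrD : (w * srefl i)%g \in Dgroup m by rewrite groupM ?srefl_Dgroup.
have er : e (orbit_pt (w * srefl i)%g).
  by apply/eq_e; split; [exact: orbit_pt_Pol|rewrite orbit_pt_srefl // dotBr dotZr ci mulr0 subr0].
have dir z : e z -> exists k, z = orbit_pt w + k *: A.
  move=> ez; have /sub_rVP[k1 k1E] := eA _ ez; have /sub_rVP[k2 k2E] := eA _ ew.
  exists (k1 - k2); rewrite scalerBl -k1E -k2E opprB.
  by rewrite [z - p + _]addrA (subrK p) addrCA subrr addr0.
have [k1 uE] := dir _ eu; have [k2 rE] := dir _ er.
exists i; apply: (orbit_pt_inj uD wrD); apply: (orbit_pt_line wD uD wrD uE rE) => //.
move=> /(orbit_pt_inj wrD wD) h.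
by have := wall_fst i; rewrite -(sreflL i) -[srefl i](mulKg w) h mulVg perm1 eqxx.
Qed.

Theorem polytope_D_graph : exists2 f : vert (D_graph m) -> vert (polytope_skeleton Pol),
  bijective f & forall g h, adj g h <-> adj (f g) (f h).
Proof.
have gP (w : vert (D_graph m)) : orbit_pt (val w) \in vertices Pol.
  by apply/mem_set/vertexP; exists (val w) => //; apply: valP.
pose f (w : vert (D_graph m)) : vert (polytope_skeleton Pol) :=
  exist (fun x => x \in vertices Pol) (orbit_pt (val w)) (gP w).
have f_inj : injective f.
  by move=> w u /(congr1 (@proj1_sig _ _)) /(orbit_pt_inj (valP w) (valP u)) /val_inj.
exists f; first apply: bijective_of_surj => // [[x xP]].
  have [w wD xE] := (vertexP x).1 (set_mem xP).
  by exists (D_vert wD); apply: val_inj; rewrite /= xE.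
move=> x y; split=> [[i yE]|[xy [e [fe de] [ex ey]]]].
  split; last by rewrite /= yE; apply: srefl_edge; apply: valP.
  move=> /f_inj xy; have := wall_fst i; rewrite -(sreflL i) -[srefl i](mulKg (val x)).
  by rewrite -yE xy mulVg perm1 eqxx.
apply: (edge_srefl (valP x) (valP y) _ fe de ex ey).
by apply/eqP => h; apply: xy; congr f; apply: val_inj.
Qed.
End Faces.
End Orbit.
End DPolytope.

Theorem proposition4 (R : realType) (d : nat) (hd : 2 <= d) (v : 'rV[R]_d)
    (hv : wythoff_point (@D_normal R d) [set: 'I_d] v) :
  graph_iso
    (skeleton (wythoffian (hyperoctahedron_complex hd)
                          [set i : 'I_d.-1.+1 | i <= d - 2]))
    (polytope_skeleton (wythoff_polytope (@D_normal R d) v)) /\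
  isometrically_embeddable
    (polytope_skeleton (wythoff_polytope (@D_normal R d) v))
    (hypercube (d * (d - 1))).
Proof.
case: d hd v hv => [|[|m]] // hd v [dom reg].
have v_pos i : (0 < dot (@D_normal R m.+2 i) v)%R.
  rewrite lt_neqAle dom andbT eq_sym; apply/eqP => /reg.
  by rewrite inE.
have [f1 f1b f1a] := wythoffian_D_graph hd.
have [f2 f2b f2a] := polytope_D_graph v_pos.
split; first exact: graph_iso_of_common f1b f1a f2b f2a.
exact: isometric_iso f2b f2a (D_graph_isometric m).
Qed.
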